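(* Let $G=(V,E)$ be a finite connected simple graph with $|E|\ge 2$. (i) For every $\mathbf{x}\in\mathcal{I}_G$ there is a rate $\lambda(\mathbf{x})>0$ such that for every sequence of configurations $\mathbf{n}^{(n)}\in\mathbb{Z}_{\ge 0}^E$, $n\ge 1$, with $\sum_{e\in E} n^{(n)}_e=n$ and $\mathbf{n}^{(n)}=n\mathbf{x}+O(1)$ as $n\to\infty$, the numbers $p_G(\mathbf{n}^{(n)})$ tend to $0$ exponentially fast at rate at least $\lambda(\mathbf{x})$, i.e. $\limsup_{n\to\infty}\frac1n\log p_G(\mathbf{n}^{(n)})\le-\lambda(\mathbf{x})$ (with $\log 0=-\infty$). Moreover the rates can be chosen so that $\inf_{\mathbf{x}\in S}\lambda(\mathbf{x})>0$ for every set $S\subset\mathcal{I}_G$ that is at positive distance from $\mathcal{R}_G$. (ii) There exists a constant $c_G>0$ (depending only on $G$) such that for every $\mathbf{x}\in\mathcal{R}_G$ and every sequence of configurations $\mathbf{n}^{(n)}\in\mathbb{Z}_{\ge 0}^E$ with $\sum_{e\in E} n^{(n)}_e=n$ and $\mathbf{n}^{(n)}=n\mathbf{x}+O(1)$, we have $p_G(\mathbf{n}^{(n)})\to c_G$ as $n\to\infty$.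
   Context: Let $k=|V|$. For $F\subset E$ let $\deg_F(v)$ be the number of edges of $F$ incident with $v$, $\deg_G(v)=\deg_E(v)$, and $d(F)=|\{v\in V:\deg_F(v)=\deg_G(v)\}|$. Let $\mathcal{S}_G=\{\mathbf{x}\in\mathbb{R}^E: x_e\ge0,\ \sum_{e\in E}x_e=1\}$ and $$\mathcal{R}_G=\{\mathbf{x}\in\mathcal{S}_G:\ \sum_{e\in F}x_e>\tfrac1k d(F)\ \text{for all } \emptyset\subsetneq F\subsetneq E\},$$ $$\mathcal{I}_G=\{\mathbf{x}\in\mathcal{S}_G:\ \sum_{e\in F}x_e<\tfrac1k d(F)\ \text{for some } \emptyset\subsetneq F\subsetneq E\}.$$ The game: start from $\mathbf{N}(0)=\mathbf{n}=(n_e:e\in E)\in\mathbb{Z}_{\ge0}^E$, with $n=\sum_{e\in E} n_e$. In each round $t=1,\dots,n$ an independent uniformly random vertex $V_t\in V$ is drawn, the player sees it and must choose an edge $e$ incident with $V_t$, and then $\mathbf{N}(t)=\mathbf{N}(t-1)-\mathbf{1}^e$, where $\mathbf{1}^e$ is the unit coordinate vector of $e$. The player wins if $\mathbf{N}(n)=(0,\dots,0)$. $p_G(\mathbf{n})$ is the probability of winning under the optimal strategy. Equivalently, $p_G(\mathbf{0})=1$, $p_G(\mathbf{n})=0$ if some coordinate of $\mathbf{n}$ is negative, and for other $\mathbf{n}$, $p_G(\mathbf{n})=\frac1k\sum_{v\in V}\max_{e\in E:\,e\sim v}p_G(\mathbf{n}-\mathbf{1}^e)$, where $e\sim v$ means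 $e$ is incident with $v$. Distances are Euclidean in $\mathbb{R}^E$. *)

(* Defs.v *)
From mathcomp Require Import all_boot all_order all_algebra.
From mathcomp Require Import all_classical all_reals all_analysis.

Set Implicit Arguments.
Unset Strict Implicit.
Unset Printing Implicit Defensive.

Import Order.TTheory GRing.Theory Num.Theory.
Import numFieldNormedType.Exports.

Local Open Scope classical_set_scope.
Local Open Scope ring_scope.

Record sgraph := SGraph {
  vertex :> finType;
  adj : rel vertex;
  adj_sym : symmetric adj;
  adj_irr : irreflexive adj }.

Definition edge (G : sgraph) : finType :=
  {A : {set G} | [exists u : G, exists v : G, adj u v && (A == [set u; v]%SET)]}.

Definition connected_graph (G : sgraph) : Prop :=
  forall u v : G, connect (@adj G) u v.

Definition incident (G : sgraph) (e : edge G) (v : G) : bool := v \in val e.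

Definition deg (G : sgraph) (F : {set edge G}) (v : G) : nat :=
  #|[set e in F | incident e v]%SET|.

Definition dfull (G : sgraph) (F : {set edge G}) : nat :=
  #|[set v : G | deg F v == deg [set: edge G]%SET v]%SET|.

Definition simplex (R : realType) (G : sgraph) : set (edge G -> R) :=
  [set x | (forall e, 0 <= x e) /\ \sum_e x e = 1].

Definition win_region (R : realType) (G : sgraph) : set (edge G -> R) :=
  [set x | simplex x /\
    forall F : {set edge G}, finset.set0 \proper F -> F \proper [set: edge G]%SET ->
      #|G|%:R^-1 * (dfull F)%:R < \sum_(e in F) x e].

Definition lose_region (R : realType) (G : sgraph) : set (edge G -> R) :=
  [set x | simplex x /\
    exists F : {set edge G}, [/\ finset.set0 \proper F, F \proper [set: edge G]%SET &
      \sum_(e in F) x e < #|G|%:R^-1 * (dfull F)%:R]].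

Definition config (G : sgraph) : Type := {ffun edge G -> int}.

Definition unit_config (G : sgraph) (e : edge G) : config G :=
  [ffun f => (f == e)%:R].

(* A deterministic, history-dependent strategy: in round t it picks the edge
   s [:: V_1; ...; V_t].  The initial configuration is fixed beforehand, so a
   strategy may depend on it, and N(t-1) is a function of V_1, ..., V_(t-1). *)
Definition strategy (G : sgraph) : Type := seq G -> edge G.

Definition admissible (G : sgraph) (s : strategy G) : Prop :=
  forall (h : seq G) (v : G), incident (s (rcons h v)) v.

(* N(t), when the vertices drawn are w = [:: V_1; V_2; ...]. *)
Fixpoint remaining (G : sgraph) (s : strategy G) (n : config G) (w : seq G)
    (t : nat) : config G :=
  if t is t'.+1 then remaining s n w t' - unit_config (s (take t w)) else n.

(* For a nonnegative configuration, this is the number n of rounds.  A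
   configuration with a negative coordinate is lost for any number of rounds. *)
Definition rounds (G : sgraph) (n : config G) : nat := absz (\sum_e n e).

(* (V_1, ..., V_n) is uniformly distributed on G^n. *)
Definition win_prob (R : realType) (G : sgraph) (n : config G)
    (s : strategy G) : R :=
  #|[set w : (rounds n).-tuple G | remaining s n w (rounds n) == 0]%SET|%:R
    / (#|G| ^ rounds n)%:R.

(* The set is finite, so the sup is a max whenever an admissible strategy exists,
   i.e. whenever G has an edge and no isolated vertex. *)
Definition opt_prob (R : realType) (G : sgraph) (n : config G) : R :=
  sup [set win_prob R n s | s in @admissible G].

Definition euclid_dist (R : realType) (G : sgraph) (x y : edge G -> R) : R :=
  Num.sqrt (\sum_e (x e - y e) ^+ 2).

Definition positive_distance (R : realType) (G : sgraph)
    (S T : set (edge G -> R)) : Prop :=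
  (0 < ereal_inf [set (euclid_dist x y)%:E | x in S & y in T])%E.

(* The O(1) term is bounded coordinatewise; N 0 is irrelevant. *)
Definition config_seq (R : realType) (G : sgraph) (x : edge G -> R)
    (N : nat -> config G) : Prop :=
  [/\ forall n, (0 < n)%N -> forall e, 0 <= N n e,
      forall n, (0 < n)%N -> \sum_e N n e = n%:Z &
      forall e, (fun n : nat => (N n e)%:~R - n%:R * x e : R^o)
        =O_\oo (fun=> 1 : R^o)].

(* [lne] is the extended logarithm, with lne 0 = -oo. *)
Definition log_rate (R : realType) (G : sgraph) (N : nat -> config G) : \bar R :=
  limn_esup (fun n => (n%:R^-1)%:E * lne (opt_prob R (N n))%:E)%E.

(* Main.v *)
Require Import Defs.
From mathcomp Require Import all_boot all_order all_algebra.
From mathcomp Require Import all_classical all_reals all_analysis.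
From mathcomp Require Import ring lra zify.
Import Order.TTheory GRing.Theory Num.Theory.
Import numFieldNormedType.Exports.
Local Open Scope classical_set_scope.
Local Open Scope ring_scope.

(** Let [value t z] be the value of the game with configuration [z] and [t]
    rounds to go, given by dynamic programming; for nonnegative [z] with sum [t]
    it is [opt_prob] ([opt_prob_value]).

    Losing region.  A vertex all of whose edges lie in [F] removes an edge of [F]
    whenever it is drawn, so the player needs a binomial variable with mean
    [n d(F) / k] to stay below about [n x(F)].  The exponential supermartingale
    behind Chernoff's bound ([value_le_exp]) gives the rate [deficit x ^+ 2 / 8],
    where [deficit x] is the largest value of [d(F) / k - x(F)].  A point of small
    deficit is close to the winning region, because a short move towards the fixed
    interior point [center] restores all the inequalities
    ([positive_distance_deficit]).

    Winning region.  Let [c] be the limit of the supremum [best n] of [value n],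
    which decreases in [n].  It bounds every limit of values from above.  For the
    lower bound two ingredients are combined.

    Steering.  From a configuration close to [n x], with [x] in the winning
    region, the player can reach a bounded neighbourhood of any prescribed
    configuration [a], with probability as close to one as desired.  The player
    removes at each vertex the edge with the largest excess over the ray through
    [a] in direction [x].  The inequalities that define the winning region say
    exactly that this greedy rule has a negative drift ([greedy_drift]), and then
    the sum over the edges of the exponentials of the excesses contracts
    ([potential_drift], [steering_sequence]).

    Large balls of nearly maximal value.  For each radius and each [eps] there is
    a configuration all of whose neighbours within that radius have value at
    least [c - eps] ([large_ball_near_limit]).  Take near-maximizers [a n] at
    level [n] and the limit [u j z] of [value (n - j) (a n - z)] along an
    ultrafilter.  Then [u] is at most [c], equals [c] at the origin, and satisfies
    the same recursion, so where [u = c] every vertex has a move that keeps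
    [u = c]: a play can stay maximal for ever.  Consider a second player whose
    configuration differs from that of a maximal play by a swap of two edges [e]
    and [f] at a vertex [v].  He copies the moves of that play until it picks [e]
    at [v], answers by [f], and has then caught up.  He succeeds with probability
    close to one if, for long enough, the pick [e] at [v] stays reachable within a
    bounded time.  Choosing the origin so that a largest possible set of picks
    is out of reach for arbitrarily long times makes every other pick reachable
    in bounded time ([max_persistent]), and every vertex has such a pick
    ([unfrozen_pick]).  As the graph is
    connected, the swaps available in this way generate all differences of sum
    zero; shifting the centre of the ball by a large multiple of their sum turns
    integer combinations of swaps into nonnegative ones ([catchable_ball]).

    Steering towards such a ball makes the lower limit of the values at least
    [c]; steering towards a ball of nonnegative configurations, where the value
    is at least [k ^- s], shows that [c] is positive. *)

Set Implicit Arguments.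
Unset Strict Implicit.
Unset Printing Implicit Defensive.

(** * Graphs, averages over the vertices and the value of the game *)

Section Graph.
Variable G : sgraph.
Hypothesis G_connected : connected_graph G.
Hypothesis G_edges : (2 <= #|edge G|)%N.

Lemma edge_of_adj (u v : G) :
  adj u v -> exists e : edge G, val e = [set u; v]%SET.
Proof.
move=> uv.
have E : [exists u0 : G, exists v0 : G,
    adj u0 v0 && ([set u; v]%SET == [set u0; v0]%SET)].
  by apply/existsP; exists u; apply/existsP; exists v; rewrite uv eqxx.
by exists (Sub [set u; v]%SET E).
Qed.

Lemma edge_incident (e : edge G) : exists v, incident e v.
Proof.
case/existsP: (valP e) => u /existsP[v /andP[_ /eqP E]].
by exists u; rewrite /incident E !inE eqxx.
Qed.

Lemma vertex_incident (v : G) : exists e : edge G, incident e v.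
Proof.
have /card_gt0P[e _] : (0 < #|edge G|)%N by apply: leq_trans G_edges.
have [u uP] := edge_incident e.
have /connectP[[|w p] /= ] := G_connected v u.
  by move=> _ E; exists e; rewrite -E.
case/andP => vw _ _; have [f fE] := edge_of_adj vw.
by exists f; rewrite /incident fE !inE eqxx.
Qed.

Lemma edge_exists : exists e : edge G, True.
Proof.
by have /card_gt0P[e _] : (0 < #|edge G|)%N by [apply: leq_trans G_edges]; exists e.
Qed.

Lemma vertices_gt0 : (0 < #|G|)%N.
Proof.
have [e _] := edge_exists; have [v _] := edge_incident e.
by apply/card_gt0P; exists v.
Qed.

Lemma greedy_choice (R : realType) (g : edge G -> R) : exists ev : G -> edge G,
  forall v, incident (ev v) v /\ forall e, incident e v -> g e <= g (ev v).
Proof.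
have H v : exists e : edge G, incident e v /\ forall f, incident f v -> g f <= g e.
  have [e0 e0P] := vertex_incident v.
  have := @arg_maxP _ _ _ e0 (fun e => incident e v) g e0P.
  by case=> e eP emax; exists e; split=> // f fv; apply: emax.
by have [ev evP] := fin_all_exists H; exists ev.
Qed.

(** Connectivity in the form used throughout: a set of edges that is closed under
    sharing a vertex is everything or nothing. *)
Lemma edge_connected (F : edge G -> Prop) :
    (forall v e f, incident e v -> incident f v -> F e -> F f) ->
  forall e f, F e -> F f.
Proof.
move=> Fcl e f Fe; have [u ue] := edge_incident e.
have [w wf] := edge_incident f.
have /connectP[p] := G_connected u w.
elim: p u e ue Fe => [|x p IH] u e ue Fe /=.
  by move=> _ E; apply: (Fcl u e) => //; rewrite -E.
case/andP => ux px wE; have [g gE] := edge_of_adj ux.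
apply: (IH x g) => //; first by rewrite /incident gE !inE eqxx orbT.
by apply: (Fcl u e) => //; rewrite /incident gE !inE eqxx.
Qed.

End Graph.

Section Average.
Variables (R : realType) (G : sgraph).

Definition average (f : G -> R) : R := #|G|%:R^-1 * \sum_v f v.

Lemma ler_average (f g : G -> R) :
  (forall v, f v <= g v) -> average f <= average g.
Proof.
move=> fg; apply: ler_wpM2l; first by rewrite invr_ge0 ler0n.
by apply: ler_sum.
Qed.

Lemma average_const (c : R) : (0 < #|G|)%N -> average (fun=> c) = c.
Proof.
move=> G0; rewrite /average sumr_const cardT -cardE -[c *+ _]mulr_natl mulrA mulVf ?mul1r //.
by rewrite pnatr_eq0 -lt0n.
Qed.

Lemma averageD (f g : G -> R) :
  average (fun v => f v + g v) = average f + average g.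
Proof. by rewrite /average big_split mulrDr. Qed.

Lemma averageZ a (f : G -> R) : average (fun v => a * f v) = a * average f.
Proof. by rewrite /average -mulr_sumr mulrCA. Qed.

Lemma average_card (A : {set G}) :
  average (fun v => (v \in A)%:R) = #|G|%:R^-1 * #|A|%:R.
Proof.
rewrite /average -sum1_card natr_sum [in RHS]big_mkcond /=; congr (_ * _).
by apply: eq_bigr => v _; case: (v \in A).
Qed.

(** A single vertex has weight [1 / k] in the average; every estimate below that
    waits for a particular vertex to be drawn rests on this. *)
Lemma average_one (v0 : G) (f : G -> R) a b :
    a <= f v0 -> (forall v, b <= f v) ->
  b + #|G|%:R^-1 * (a - b) <= average f.
Proof.
move=> av bf.
have G0 : (0 < #|G|)%N by apply/card_gt0P; exists v0.
apply: (@le_trans _ _ (average (fun v => b + (a - b) * (v \in [set v0]%SET)%:R))).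
  by rewrite averageD averageZ average_const // average_card cards1 mulr1 mulrC.
apply: ler_average => v; rewrite inE; case: eqP => [->|_]; last by rewrite mulr0 addr0.
by rewrite mulr1 addrC subrK.
Qed.

End Average.

Section Value.
Variables (R : realType) (G : sgraph).
Local Notation average := (@average R G).

(** The level [t] is an explicit argument, so that configurations with negative
    coordinates need no special treatment: they can never be cleared and get the
    value zero. *)
Fixpoint value (t : nat) (z : config G) : R :=
  if t is t'.+1
  then average (fun v =>
         \big[Num.max/0]_(e | incident e v) value t' (z - unit_config e))
  else (z == 0)%:R.

Lemma value_ge0 t z : 0 <= value t z.
Proof.
case: t => [|t] /=; first by rewrite ler0n.
rewrite mulr_ge0 ?invr_ge0 ?ler0n // sumr_ge0 // => v _.
exact: bigmax_ge_id.
Qed.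

Lemma value_super t z (ev : G -> edge G) : (forall v, incident (ev v) v) ->
  average (fun v => value t (z - unit_config (ev v))) <= value t.+1 z.
Proof.
move=> evP; apply: ler_average => v.
exact: (le_bigmax_cond _ (fun e => value t (z - unit_config e)) (evP v)).
Qed.

Hypothesis G_connected : connected_graph G.
Hypothesis G_edges : (2 <= #|edge G|)%N.

Lemma value_opt t z : exists ev : G -> edge G, (forall v, incident (ev v) v) /\
  value t.+1 z = average (fun v => value t (z - unit_config (ev v))).
Proof.
have [ev evP] := greedy_choice G_connected G_edges
  (fun e => value t (z - unit_config e)).
exists ev; split=> [v|]; first by case: (evP v).
apply/eqP; rewrite eq_le value_super ?andbT; last by move=> v; case: (evP v).
apply: ler_average => v; apply: bigmax_le; first exact: value_ge0.
by case: (evP v).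
Qed.

Lemma value_le1 t z : value t z <= 1.
Proof.
elim: t z => [|t IH] z; first by rewrite /=; case: eqP.
have [ev [_ ->]] := value_opt t z.
rewrite -[X in _ <= X](@average_const R G) ?(vertices_gt0 G_edges) //.
exact: ler_average.
Qed.

Lemma sum_unit_config (e : edge G) : \sum_f unit_config e f = 1.
Proof.
rewrite (bigD1 e) //= ffunE eqxx big1 ?addr0 // => f /negbTE fe.
by rewrite ffunE fe.
Qed.

Lemma sum_sub_unit (z : config G) (e : edge G) :
  \sum_f (z - unit_config e) f = \sum_f z f - 1.
Proof.
rewrite -(sum_unit_config e) -sumrB.
by apply: eq_bigr => f _; rewrite !ffunE.
Qed.

(** One edge is removed per round, hence only configurations of sum [t] can be
    cleared in [t] rounds. *)
Lemma value_sum t z : value t z != 0 -> \sum_e z e = t%:Z.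
Proof.
elim: t z => [|t IH] z.
  rewrite /= pnatr_eq0 eqb0 negbK => /eqP ->.
  by rewrite big1 // => e _; rewrite ffunE.
have [ev [_ ->]] := value_opt t z => nz.
have [v vP] : exists v, value t (z - unit_config (ev v)) != 0.
  apply: contrapT => H; case/eqP: nz; rewrite /average big1 ?mulr0 // => v _.
  by apply/eqP; apply: contrapT => /negP; apply: contra_not H => ?; exists v.
by have := IH _ vP; rewrite sum_sub_unit => H; lia.
Qed.

(** The vertices may happen to be endpoints of the edges still to be removed. *)
Lemma value_gt0 t (z : config G) : (forall e, 0 <= z e) -> \sum_e z e = t%:Z ->
  #|G|%:R^-1 ^+ t <= value t z.
Proof.
have V0 : 0 <= #|G|%:R^-1 :> R by rewrite invr_ge0 ler0n.
elim: t z => [|t IH] z z0 zt.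
  rewrite expr0 /=; suff -> : z = 0 by rewrite eqxx.
  by apply/ffunP => e; rewrite ffunE; apply: (psumr_eq0P _ zt).
have [e0 e0P] : exists e, 0 < z e.
  apply: contrapT => H; suff: \sum_e z e <= 0 by rewrite zt.
  apply: sumr_le0 => e _; rewrite leNgt; apply/negP => ze; apply: H; by exists e.
have [v0 v0P] := edge_incident e0.
rewrite exprS /=; apply: (ler_wpM2l V0).
apply: (le_trans (IH (z - unit_config e0) _ _)).
- move=> e; rewrite !ffunE; case: eqP => [->|_] /=; last by rewrite subr0.
  by rewrite subr_ge0 -gtz0_ge1.
- by rewrite sum_sub_unit zt; lia.
rewrite (bigD1 v0) //=; apply: (@le_trans _ _
  (\big[Num.max/0]_(e | incident e v0) value t (z - unit_config e))).
  exact: (le_bigmax_cond _ (fun e => value t (z - unit_config e)) v0P).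
by rewrite lerDl sumr_ge0 // => v _; apply: bigmax_ge_id.
Qed.

End Value.

(** * The optimal winning probability is the value *)

Section Optimal.
Variables (R : realType) (G : sgraph).
Hypothesis G_connected : connected_graph G.
Hypothesis G_edges : (2 <= #|edge G|)%N.
Local Notation average := (@average R G).
Local Notation value := (@value R G).

(** After the first round the game continues with the strategy that remembers the
    first vertex. *)
Lemma remaining_cons (s : strategy G) z v w t :
  remaining s z (v :: w) t.+1 =
  remaining (fun h => s (v :: h)) (z - unit_config (s [:: v])) w t.
Proof.
elim: t => [|t IH]; first by rewrite /= take0.
have -> : remaining s z (v :: w) t.+2 =
  remaining s z (v :: w) t.+1 - unit_config (s (take t.+2 (v :: w))) by [].
by rewrite IH.
Qed.

Lemma eq_remaining (s s' : strategy G) z w t :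
    (forall h, h != [::] -> s h = s' h) -> (t <= size w)%N ->
  remaining s z w t = remaining s' z w t.
Proof.
move=> ss'; elim: t => [//|t IH] tw /=.
rewrite IH ?ss' //; last exact: ltnW.
by rewrite -size_eq0 size_takel.
Qed.

Definition strategy_value (t : nat) (z : config G) (s : strategy G) : R :=
  #|[set w : t.-tuple G | remaining s z w t == 0]%SET|%:R / (#|G| ^ t)%:R.

Lemma strategy_valueS t z (s : strategy G) :
  strategy_value t.+1 z s = average (fun v =>
    strategy_value t (z - unit_config (s [:: v])) (fun h => s (v :: h))).
Proof.
rewrite /strategy_value /average -mulr_suml expnS natrM invfM mulrCA.
congr (_ * (_ / _)).
rewrite -natr_sum -sum1_card; congr (_%:R).
under [RHS]eq_bigr do rewrite -sum1_card.
rewrite pair_big_dep /=.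
pose f (p : G * t.-tuple G) : t.+1.-tuple G := [tuple of p.1 :: p.2].
pose g (w : t.+1.-tuple G) : G * t.-tuple G := (thead w, [tuple of behead w]).
rewrite (reindex f) /=; last first.
  exists g => [[v w]|w] _; last by rewrite /f /g /= -tuple_eta.
  by rewrite /f /g /= theadE; congr pair; apply: val_inj.
apply: eq_bigl => -[v w]; rewrite !inE.
by rewrite -(remaining_cons s z v w t).
Qed.

Lemma strategy_value_le t z (s : strategy G) : admissible s ->
  strategy_value t z s <= value t z.
Proof.
elim: t z s => [|t IH] z s sP.
  rewrite /strategy_value /= expn0 divr1 ler_nat.
  case: (boolP (z == 0)) => z0.
    by rewrite (leq_trans (max_card _)) // card_tuple expn0.
  by rewrite leqn0 cards_eq0; apply/eqP/setP => w; rewrite !inE; exact: negbTE.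
rewrite strategy_valueS.
have evP v : incident (s [:: v]) v by apply: (sP [::]).
apply: le_trans (value_super R t z evP).
apply: ler_average => v; apply: IH => h v'; exact: (sP (v :: h)).
Qed.

(** Optimal strategies for the continuations, one for each first vertex, are
    glued along the first vertex. *)
Lemma value_attained t z :
  exists s : strategy G, admissible s /\ strategy_value t z s = value t z.
Proof.
have [e0 _] := edge_exists G_edges.
elim: t z => [|t IH] z.
  have /fin_all_exists[ev evP] := vertex_incident G_connected G_edges.
  exists (fun h => if h is v :: h' then ev (last v h') else e0); split.
    by case=> [|a h] v /=; rewrite ?last_rcons.
  rewrite /strategy_value /= expn0 divr1; congr (_%:R).
  case: (boolP (z == 0)) => z0.
    rewrite -[RHS](expn0 #|G|) -card_tuple -cardsT.
    by apply: eq_card => w; rewrite !inE.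
  by apply/eqP; rewrite cards_eq0; apply/eqP/setP => w; rewrite !inE.
have [ev [evP ->]] := value_opt R G_connected G_edges t z.
have /fin_all_exists[sv svP] := fun v => IH (z - unit_config (ev v)).
exists (fun h => if h is v :: h' then if h' is [::] then ev v else sv v h' else e0).
split.
  case=> [|a [|b h]] v /=; first exact: evP.
    by case: (svP a) => + _ => /(_ [::] v).
  by case: (svP a) => + _ => /(_ (b :: h) v).
rewrite strategy_valueS /average; congr (_ * _); apply: eq_bigr => v _.
case: (svP v) => _ <-; rewrite /strategy_value; congr (_%:R / _).
apply: eq_card => w; rewrite !inE (@eq_remaining _ (sv v)) ?size_tuple //.
by case.
Qed.

Lemma opt_prob_value (z : config G) : opt_prob R z = value (rounds z) z.
Proof.
have [s [sP sE]] := value_attained (rounds z) z.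
have sz : [set win_prob R z s | s in @admissible G] (value (rounds z) z).
  by exists s.
have ub : ubound [set win_prob R z s | s in @admissible G] (value (rounds z) z).
  by move=> _ [s' s'P <-]; apply: strategy_value_le.
apply/eqP; rewrite eq_le; apply/andP; split.
  by apply: ge_sup => //; exists (value (rounds z) z).
by apply: ub_le_sup => //; exists (value (rounds z) z).
Qed.

End Optimal.

(** * Exponential decay in the losing region *)

Section Losing.
Variables (R : realType) (G : sgraph).
Hypothesis G_connected : connected_graph G.
Hypothesis G_edges : (2 <= #|edge G|)%N.
Local Notation average := (@average R G).
Local Notation value := (@value R G).

(** From [1 - s <= expR (- s)], by taking inverses. *)
Lemma expR_le_quad (s : R) : s <= 2^-1 -> expR s <= 1 + s + 2 * s ^+ 2.
Proof.
move=> s2; have s1 : 0 < 1 - s by lra.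
rewrite -[s in expR s]opprK expRN.
apply: (@le_trans _ _ (1 - s)^-1).
  by rewrite lef_pV2 ?posrE ?expR_gt0 // expR_ge1Dx.
rewrite -[leLHS]mul1r ler_pdivrMr //.
have : 0 <= s ^+ 2 by exact: sqr_ge0.
rewrite !expr2; nra.
Qed.

(** The vertices counted by [dfull F] are those at which no edge outside [F] can
    be chosen. *)
Lemma mem_full (F : {set edge G}) (v : G) :
  reflect (forall e, incident e v -> e \in F)
          (deg F v == deg [set: edge G]%SET v).
Proof.
have sub : [set e in F | incident e v]%SET \subset [set e in [set: edge G]%SET | incident e v]%SET.
  by apply/fintype.subsetP => e; rewrite !inE => /andP[].
apply: (iffP idP) => [/eqP E e ev|H].
  have /eqP/setP/(_ e) : [set e in F | incident e v]%SET ==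
      [set e in [set: edge G]%SET | incident e v]%SET.
    by rewrite eqEcard sub /= -/(deg F v) E leqnn.
  by rewrite !inE ev andbT.
rewrite eqn_leq subset_leq_card //= subset_leq_card //.
by apply/fintype.subsetP => e; rewrite !inE /= => ev; rewrite H.
Qed.

(** Chernoff's bound.  Whatever the player does, drawing a vertex all of whose
    edges lie in [F] lowers the number of edges left in [F] by one, and it is
    never raised; so the exponential of [th] times that number contracts on
    average at least by the factor [1 - (1 - expR (- th)) * d(F) / k]. *)
Lemma value_le_exp (F : {set edge G}) (th : R) t z : 0 <= th <= 2^-1 ->
  value t z <= expR (th * (\sum_(e in F) z e)%:~R
                - t%:R * ((th - 2 * th ^+ 2) * (#|G|%:R^-1 * (dfull F)%:R))).
Proof.
move=> /andP[th0 th2].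
set d := #|G|%:R^-1 * _; set c := _ * d.
have G0 := vertices_gt0 G_edges.
elim: t z => [|t IH] z.
  rewrite mul0r subr0 /=; case: eqP => [->|_]; last exact: expR_ge0.
  by rewrite big1 ?mulr0 ?expR0 // => e _; rewrite ffunE.
have [ev [evP ->]] := value_opt R G_connected G_edges t z.
set m := th * _.
pose D := [set v : G | deg F v == deg [set: edge G]%SET v]%SET.
have step v : value t (z - unit_config (ev v)) <=
    expR (m - t%:R * c) * (1 + (expR (- th) - 1) * (v \in D)%:R).
  apply: (le_trans (IH _)); rewrite !expRD [leRHS]mulrAC.
  apply: ler_wpM2r; first exact: expR_ge0.
  have -> : \sum_(e in F) (z - unit_config (ev v)) e =
      \sum_(e in F) z e - (ev v \in F)%:R.
    have <- : \sum_(e in F) unit_config (ev v) e = (ev v \in F)%:R.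
      case: (boolP (ev v \in F)) => evF.
        rewrite (bigD1 (ev v)) //= ffunE eqxx big1 ?addr0 // => e /andP[_ /negbTE eev].
        by rewrite ffunE eev.
      rewrite big1 // => e eF; rewrite ffunE; case: eqP => // E.
      by rewrite -E eF in evF.
    by rewrite -sumrB; apply: eq_bigr => e _; rewrite !ffunE.
  rewrite intrB mulrBr expRD; apply: ler_wpM2l; first exact: expR_ge0.
  rewrite inE; case: mem_full => [/(_ _ (evP v)) ->|_] /=.
    by rewrite mulr1z mulr1; lra.
  by rewrite mulr0 addr0 -expR0 ler_expR oppr_le0 mulr_ge0 //.
apply: (le_trans (ler_average step)); rewrite averageZ averageD average_const //.
rewrite averageZ average_card -/(dfull F) -/d.
have -> : m - t.+1%:R * c = (m - t%:R * c) + - c by rewrite -[t.+1%:R]natr1; ring.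
rewrite [leRHS]expRD; apply: ler_wpM2l; first exact: expR_ge0.
apply: (le_trans _ (expR_ge1Dx _)).
rewrite lerD2l /c -mulNr; apply: ler_wpM2r.
  by rewrite mulr_ge0 ?invr_ge0 ?ler0n.
have := @expR_le_quad (- th); rewrite sqrrN => H.
by rewrite lerBlDr (le_trans (H _)) //; lra.
Qed.

(** The largest violation of the inequalities of the winning region; the sets
    [set0] and [setT] contribute zero. *)
Definition deficit (x : edge G -> R) : R :=
  \big[Num.max/0]_(F : {set edge G}) (#|G|%:R^-1 * (dfull F)%:R - \sum_(e in F) x e).

Lemma deficit_ge (x : edge G -> R) (F : {set edge G}) :
  #|G|%:R^-1 * (dfull F)%:R - \sum_(e in F) x e <= deficit x.
Proof.
exact: (@le_bigmax_cond _ _ _ 0 F predT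
  (fun F => #|G|%:R^-1 * (dfull F)%:R - \sum_(e in F) x e)).
Qed.

Lemma deficit_gt0 (x : edge G -> R) : lose_region x -> 0 < deficit x.
Proof.
move=> [_ [F [_ _ FP]]]; apply: lt_le_trans (deficit_ge x F).
by rewrite subr_gt0.
Qed.

Lemma deficit_attained (x : edge G -> R) : 0 < deficit x ->
  exists F : {set edge G}, deficit x = #|G|%:R^-1 * (dfull F)%:R - \sum_(e in F) x e.
Proof.
move=> d0; apply: contrapT => H; suff: deficit x < deficit x by rewrite ltxx.
apply: bigmax_lt => // F _; rewrite lt_neqAle deficit_ge andbT.
by apply/eqP => E; apply: H; exists F.
Qed.

Lemma frac_full_le1 (F : {set edge G}) : #|G|%:R^-1 * (dfull F)%:R <= 1 :> R.
Proof.
have G0 := vertices_gt0 G_edges.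
by rewrite mulrC ler_pdivrMr ?ltr0n // mul1r ler_nat max_card.
Qed.

Lemma deficit_le1 (x : edge G -> R) : (forall e, 0 <= x e) -> deficit x <= 1.
Proof.
move=> x0; apply: bigmax_le => // F _.
have := frac_full_le1 F; have : 0 <= \sum_(e in F) x e by apply: sumr_ge0.
by lra.
Qed.

Lemma config_seq_bounded (x : edge G -> R) N : config_seq x N ->
  exists M : R, exists n0 : nat, 0 <= M /\ forall n e, (n0 <= n)%N ->
    `|(N n e)%:~R - n%:R * x e| <= M.
Proof.
move=> [_ _ HO].
have H e : exists p : R * nat, 0 <= p.1 /\ forall n, (p.2 <= n)%N ->
    `|(N n e)%:~R - n%:R * x e| <= p.1.
  have /eqO_exP [M M0 [n0 _ n0P]] := HO e.
  exists (M, n0); split; first exact: ltW.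
  by move=> n n0n; have := n0P n n0n; rewrite /= normr1 mulr1.
have /fin_all_exists[p pP] := H.
exists (\sum_e (p e).1), (\sum_e (p e).2)%N; split.
  by apply: sumr_ge0 => e _; case: (pP e).
move=> n e ne; apply: (@le_trans _ _ (p e).1).
  by case: (pP e) => _; apply; apply: leq_trans ne; rewrite (bigD1 e) //= leq_addr.
by rewrite (bigD1 e) //= lerDl; apply: sumr_ge0 => f _; case: (pP f).
Qed.

Lemma config_seq_value (x : edge G -> R) N n : config_seq x N -> (0 < n)%N ->
  opt_prob R (N n) = value n (N n).
Proof.
move=> [_ + _] n0 => /(_ n n0) E.
by rewrite opt_prob_value // /rounds E.
Qed.

(** The exponent [th * deficit x - 2 * th ^+ 2] per round is maximal at
    [th = deficit x / 4], where it is [deficit x ^+ 2 / 8]. *)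
Lemma value_decay (x : edge G -> R) N : simplex x -> 0 < deficit x ->
  config_seq x N -> exists C : R, exists n0 : nat, forall n, (n0 <= n)%N ->
    value n (N n) <= expR (C - n%:R * (deficit x ^+ 2 / 8)).
Proof.
move=> [x0 _] d0 HN; have [M [n0 [M0 n0P]]] := config_seq_bounded HN.
have [F FE] := deficit_attained d0.
have d1 := deficit_le1 x0.
exists (\sum_(e in F) M), n0 => n n0n.
pose th := deficit x / 4.
have th2 : 0 <= th <= 2^-1 by rewrite /th; lra.
apply: (le_trans (value_le_exp F _ _ th2)); rewrite ler_expR.
have NF : (\sum_(e in F) N n e)%:~R <= n%:R * \sum_(e in F) x e + \sum_(e in F) M.
  rewrite rmorph_sum mulr_sumr -big_split; apply: ler_sum => e _ /=.
  by have := n0P n e n0n; rewrite ler_norml => /andP[_]; lra.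
have M1 : 0 <= \sum_(e in F) M by apply: sumr_ge0.
have dF1 := frac_full_le1 F.
have FE' : \sum_(e in F) x e = #|G|%:R^-1 * (dfull F)%:R - deficit x by rewrite FE; lra.
rewrite {}FE' in NF.
move: NF M1 dF1; set S : R := (\sum_(e in F) N n e)%:~R.
set M' := \sum_(e in F) M; set D : R := #|G|%:R^-1 * (dfull F)%:R => NF M1 dF1.
have th0 : 0 <= th by case/andP: th2.
have n0' : 0 <= n%:R :> R by rewrite ler0n.
have K1 : th * S <= th * (n%:R * (D - deficit x) + M') by apply: ler_wpM2l.
have K2 : th * M' <= M' by rewrite -[leRHS]mul1r; apply: ler_wpM2r => //; lra.
have K3 : n%:R * (2 * th ^+ 2 * D) <= n%:R * (2 * th ^+ 2).
  apply: ler_wpM2l => //; rewrite -[leRHS]mulr1; apply: ler_wpM2l => //.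
  by rewrite mulr_ge0 // sqr_ge0.
have E : n%:R * (deficit x ^+ 2 / 8) = n%:R * (th * deficit x) - n%:R * (2 * th ^+ 2).
  by rewrite /th; field.
rewrite E; rewrite mulrDr in K1; lra.
Qed.

Lemma log_rate_le (x : edge G -> R) N : simplex x -> 0 < deficit x ->
  config_seq x N -> (log_rate R N <= (- (deficit x ^+ 2 / 8))%:E)%E.
Proof.
move=> xS d0 HN; have [C [n0 n0P]] := value_decay xS d0 HN.
apply/lee_addgt0Pr => eps eps0.
rewrite /log_rate /limn_esup limf_esupE.
pose n1 := (maxn n0 (Num.bound (`|C| / eps)).+1).
apply: (@le_trans _ _ (ereal_sup
    [set ((n%:R^-1)%:E * lne (opt_prob R (N n))%:E)%E | n in [set n | (n1 <= n)%N]])).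
  by apply: ereal_inf_lbound; exists [set n | (n1 <= n)%N] => //; exists n1.
apply: ge_ereal_sup => _ [n /= n1n <-].
have nn0 : (n0 <= n)%N by apply: leq_trans n1n; rewrite leq_maxl.
have nB : ((Num.bound (`|C| / eps)).+1 <= n)%N by apply: leq_trans n1n; rewrite leq_maxr.
have npos : (0 < n)%N by apply: leq_trans nB.
have npos' : 0 < n%:R :> R by rewrite ltr0n.
rewrite (config_seq_value HN npos).
have := n0P n nn0; set V := value n (N n) => VP.
have [V0|V0] := leP V 0.
  have np : (0 < (n%:R^-1 : R)%:E)%E by rewrite lte_fin invr_gt0.
  by rewrite (gt0_muleNy np) leNye.
rewrite -EFinM -EFinD lee_fin.
have lnV : ln V <= C - n%:R * (deficit x ^+ 2 / 8).
  by rewrite -[leRHS]expRK ler_ln ?posrE ?expR_gt0.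
have Cn : C <= n%:R * eps.
  rewrite (le_trans (ler_norm _)) // -ler_pdivrMr //.
  apply: ltW; apply: (lt_le_trans (archi_boundP _)); first by rewrite divr_ge0 // ltW.
  by rewrite ler_nat; apply: ltnW.
rewrite mulrC ler_pdivrMr // (le_trans lnV) //; nra.
Qed.

End Losing.

(** * Interior points of the winning region *)

Section Region.
Variables (R : realType) (G : sgraph).
Hypothesis G_connected : connected_graph G.
Hypothesis G_edges : (2 <= #|edge G|)%N.
Local Notation average := (@average R G).

Lemma finite_lower_bound (I : finType) (P : pred I) (f : I -> R) :
  (forall i, P i -> 0 < f i) ->
  exists eta : R, 0 < eta <= 1 /\ forall i, P i -> eta <= f i.
Proof.
move=> f0; exists (\big[Num.min/1]_(i | P i) f i); split.
  by rewrite lt_bigmin //= bigmin_le_id.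
by move=> i Pi; apply: bigmin_le_cond.
Qed.

Definition proper_nonempty (F : {set edge G}) : bool :=
  (finset.set0 \proper F) && (F \proper [set: edge G]%SET).

Lemma win_region_slack (x : edge G -> R) : win_region x ->
  exists eta : R, 0 < eta <= 1 /\ forall F : {set edge G}, proper_nonempty F ->
    #|G|%:R^-1 * (dfull F)%:R + eta <= \sum_(e in F) x e.
Proof.
move=> [_ xP].
have [|eta [eta01 etaP]] := @finite_lower_bound {set edge G} proper_nonempty
  (fun F => \sum_(e in F) x e - #|G|%:R^-1 * (dfull F)%:R).
  by move=> F /andP[F0 FT]; rewrite subr_gt0 xP.
exists eta; split=> // F FP; have := etaP F FP; lra.
Qed.

Lemma deg_gt0 (v : G) : (0 < deg [set: edge G]%SET v)%N.
Proof.
have [e ev] := vertex_incident G_connected G_edges v.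
by apply/card_gt0P; exists e; rewrite !inE.
Qed.

(** The expected frequency of the edges if every vertex chooses among its edges
    uniformly. *)
Definition center (e : edge G) : R :=
  average (fun v => (incident e v)%:R / (deg [set: edge G]%SET v)%:R).

Lemma sum_center (F : {set edge G}) : \sum_(e in F) center e =
  average (fun v => (deg F v)%:R / (deg [set: edge G]%SET v)%:R).
Proof.
rewrite /center /average -mulr_sumr exchange_big /=; congr (_ * _).
apply: eq_bigr => v _; rewrite -mulr_suml; congr (_ / _).
rewrite -natr_sum /deg -sum1_card; congr (_%:R).
rewrite [RHS](eq_bigl (fun e => (e \in F) && incident e v)); last by move=> e; rewrite inE.
by rewrite big_mkcondr; apply: eq_bigr => e _; case: (incident e v).
Qed.

Lemma center_ge0 e : 0 <= center e.
Proof.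
by apply: mulr_ge0; rewrite ?invr_ge0 ?ler0n // sumr_ge0 // => v _; rewrite divr_ge0.
Qed.

Lemma center_simplex : simplex center.
Proof.
split; first exact: center_ge0.
have -> : \sum_e center e = \sum_(e in [set: edge G]%SET) center e.
  by apply: eq_bigl => e; rewrite inE.
rewrite sum_center -[RHS](@average_const R G 1) ?vertices_gt0 //.
congr (_ * _); apply: eq_bigr => v _; rewrite divff // pnatr_eq0 -lt0n.
exact: deg_gt0.
Qed.

(** If every vertex had all or none of its edges in [F], then [F] would be empty
    or full by connectivity.  A vertex with edges both inside and outside [F]
    sometimes picks [F] without being forced to, which gives strict inequality. *)
Lemma center_win : win_region center.
Proof.
split; first exact: center_simplex.
move=> F F0 FT.
have [v0 [e0 [f0 [e0v f0v e0F f0F]]]] : exists v : G, exists e f : edge G,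
    [/\ incident e v, incident f v, e \in F & f \notin F].
  apply: contrapT => H.
  have /fintype.properP[_ [e1 e1F _]] := F0.
  have /fintype.properP[_ [f1 _ /negP]] := FT; apply.
  suff cl : forall v e f, incident e v -> incident f v -> e \in F -> f \in F.
    exact: (edge_connected G_connected (F := fun e => e \in F) cl f1 e1F).
  move=> v e f ev fv eF.
  by apply: contrapT => /negP fF; apply: H; exists v, e, f.
rewrite sum_center -average_card.
pose D := [set v : G | deg F v == deg [set: edge G]%SET v]%SET.
have degP v : 0 < (deg [set: edge G]%SET v)%:R :> R by rewrite ltr0n deg_gt0.
pose f v : R := (deg F v)%:R / (deg [set: edge G]%SET v)%:R - (v \in D)%:R.
have -> : average (fun v => (deg F v)%:R / (deg [set: edge G]%SET v)%:R) =
    average (fun v => (v \in D)%:R) + average f.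
  rewrite -averageD; congr (_ * _); apply: eq_bigr => v _.
  by rewrite /f addrC subrK.
rewrite ltrDl.
have fge0 v : 0 <= f v.
  rewrite /f inE; case: eqP => [->|_] /=; first by rewrite divff ?subrr // gt_eqF.
  by rewrite subr0 divr_ge0.
apply: (lt_le_trans _ (average_one (lexx (f v0)) fge0)).
rewrite add0r subr0 mulr_gt0 ?invr_gt0 ?ltr0n ?vertices_gt0 // /f.
have -> : (v0 \in D) = false.
  rewrite inE; case: mem_full => // /(_ _ f0v).
  by rewrite (negbTE f0F).
rewrite subr0 divr_gt0 // ltr0n; apply/card_gt0P; exists e0.
by rewrite !inE e0F.
Qed.

(** Moving from [x] towards [center] by the fraction [s = 2 g / (2 g + eta)],
    where [g] is the deficit of [x] and [eta] the slack of [center], ends in the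
    winning region, as [s * eta] exceeds [(1 - s) * g].  The distance covered is
    of order [g], so it can be bounded below only if [g] is. *)
Lemma positive_distance_deficit (S : set (edge G -> R)) :
    S `<=` @lose_region R G -> positive_distance S (@win_region R G) ->
  exists eps : R, 0 < eps /\ forall x, S x -> eps <= deficit x.
Proof.
move=> SL Sd.
have [eta [/andP[eta0 eta1] etaP]] := win_region_slack center_win.
have [r [r0 rP]] : exists r : R, 0 < r /\ forall x y, S x -> win_region y ->
    r <= euclid_dist x y.
  move: Sd; rewrite /positive_distance; set i := ereal_inf _ => i0.
  have lb x y : S x -> win_region y -> (i <= (euclid_dist x y)%:E)%E.
    by move=> Sx Wy; apply: ereal_inf_lbound; exists x => //; exists y.
  case: i i0 lb => [r||] // r0 lb.
    by exists r; split=> // x y Sx Wy; have := lb x y Sx Wy; rewrite lee_fin.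
  exists 1; split=> // x y Sx Wy; by have := lb x y Sx Wy; rewrite leye_eq.
pose m : R := #|edge G|%:R.
have m0 : 0 < m by rewrite ltr0n (leq_trans _ G_edges).
exists (r * eta / (2 * m)); split; first by rewrite divr_gt0 ?mulr_gt0.
move=> x Sx; have Lx := SL x Sx.
have d0 := deficit_gt0 Lx; have [[x0 x1] _] := Lx.
set g := deficit x in d0 *.
pose s := 2 * g / (2 * g + eta).
have q0 : 0 < 2 * g + eta by lra.
have s0 : 0 < s by rewrite divr_gt0 ?mulr_gt0.
have s1 : s <= 1 by rewrite ler_pdivrMr //; lra.
have sE : s * (2 * g + eta) = 2 * g by rewrite /s; field; rewrite gt_eqF.
pose y e := (1 - s) * x e + s * center e.
have Wy : win_region y.
  have [c0 c1] := center_simplex.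
  split.
    split=> [e|].
      by rewrite addr_ge0 // mulr_ge0 ?center_ge0 // ?subr_ge0 // ltW.
    by rewrite big_split -mulr_sumr -mulr_sumr /= x1 c1; ring.
  move=> F F0 FT; rewrite big_split -mulr_sumr -mulr_sumr /=.
  have := etaP F; rewrite /proper_nonempty F0 FT => /(_ isT).
  have := deficit_ge x F; rewrite -/g.
  set A := #|G|%:R^-1 * _; set X := \sum_(e in F) x e; set C := \sum_(e in F) center e.
  move=> h1 h2.
  have h1' : (1 - s) * (A - g) <= (1 - s) * X by apply: ler_wpM2l; lra.
  have h2' : s * (A + eta) <= s * C by apply: ler_wpM2l; lra.
  have : 0 < s * eta - (1 - s) * g.
    have -> : s * eta - (1 - s) * g = g * (1 - s).
      have -> : s * eta = 2 * g - 2 * g * s by rewrite -{1}sE; ring.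
      ring.
    by rewrite mulr_gt0 // subr_gt0 ltr_pdivrMr //; lra.
  lra.
have dist_le : euclid_dist x y <= s * m.
  have sm0 : 0 <= s * m by rewrite mulr_ge0 ?ltW.
  rewrite -[leRHS](ger0_norm sm0) -sqrtr_sqr ler_wsqrtr //.
  apply: (@le_trans _ _ (\sum_(e : edge G) s ^+ 2)).
    apply: ler_sum => e _.
    have -> : x e - y e = s * (x e - center e) by rewrite /y; ring.
    rewrite exprMn -[leRHS]mulr1; apply: ler_wpM2l; first exact: sqr_ge0.
    have le1 (z : edge G -> R) : simplex z -> z e <= 1.
      by move=> [z0 <-]; rewrite (bigD1 e) //= lerDl sumr_ge0.
    have := le1 x (proj1 Lx); have := le1 center center_simplex.
    have := x0 e; have := center_ge0 e; rewrite expr2; nra.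
  rewrite sumr_const -mulr_natr [(s * m) ^+ 2]exprMn; apply: ler_wpM2l; first exact: sqr_ge0.
  rewrite -/m expr2 -[leLHS]mul1r; apply: ler_wpM2r; first exact: ltW.
  by rewrite ler1n (leq_trans _ G_edges).
have rs : r <= s * m by apply: le_trans (rP x y Sx Wy) dist_le.
have s2 : s * eta <= 2 * g.
  by rewrite -sE; apply: ler_wpM2l; lra.
rewrite ler_pdivrMr ?mulr_gt0 //.
apply: (@le_trans _ _ (s * m * eta)); first by apply: ler_wpM2r => //; exact: ltW.
rewrite mulrAC mulrA; apply: ler_wpM2r; first exact: ltW.
lra.
Qed.

End Region.

(** * Steering along a winning ray *)

Lemma geometric_small (R : realType) (c rho eps : R) :
  0 <= c -> 0 < rho <= 1 -> 0 < eps ->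
  exists i0, forall i, (i0 <= i)%N -> c * (1 - rho) ^+ i <= eps.
Proof.
move=> c0 /andP[r0 r1] e0.
have : c * (1 - rho) ^+ i @[i --> \oo] --> c * 0.
  by apply: cvgMr; apply: cvg_expr; rewrite ger0_norm; lra.
rewrite mulr0 => /cvgrPdist_le /(_ _ e0) [i0 _ i0P].
exists i0 => i /i0P /=; rewrite sub0r normrN => H; apply: le_trans H; exact: ler_norm.
Qed.

Section Steering.
Variables (R : realType) (G : sgraph).
Hypothesis G_connected : connected_graph G.
Hypothesis G_edges : (2 <= #|edge G|)%N.
Local Notation average := (@average R G).
Local Notation value := (@value R G).

Variables (x : edge G -> R) (eta : R).
Hypothesis x_simplex : simplex x.
Hypothesis eta_gt0 : 0 < eta <= 1.
Hypothesis x_slack : forall F : {set edge G}, proper_nonempty F ->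
  #|G|%:R^-1 * (dfull F)%:R + eta <= \sum_(e in F) x e.

(** The strict inequalities of the winning region, integrated over the level sets
    of [g].  Lowering the top level of [g] to the next one, on the complement of
    the set [L] of lower edges, changes the right-hand side by the gap times
    [x(L) - d(L) / k], which is at least [eta] times the gap; the induction is on
    the number of edges below the top.  That the choice [ev] is greedy means that
    it picks an edge of [L] only at the vertices counted by [dfull L]. *)
Lemma greedy_drift_max (n : nat) (g : edge G -> R) (ev : G -> edge G) (em : edge G) :
    (#|[set e | (g e < g em)%R]%SET| <= n)%N ->
    (forall v, incident (ev v) v) ->
    (forall v e, incident e v -> g e <= g (ev v)) ->
    (forall e, g e <= g em) ->
  forall e2, eta * (g em - g e2) <= average (fun v => g (ev v)) - \sum_e x e * g e.
Proof.
move=> + evP; have G0 := vertices_gt0 G_edges; have [_ x1] := x_simplex.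
have flat (h : edge G -> R) : [set e | h e < h em]%SET = finset.set0 ->
    (forall e, h e <= h em) -> forall e2,
    eta * (h em - h e2) <= average (fun v => h (ev v)) - \sum_e x e * h e.
  move=> L0 hmax e2; have hE e : h e = h em.
    apply/eqP; rewrite eq_le hmax leNgt; apply/negP => he.
    by move/setP/(_ e): L0; rewrite !inE he.
  have -> : (fun v => h (ev v)) = (fun=> h em) by apply/funext => v; rewrite hE.
  rewrite average_const // hE subrr mulr0; under eq_bigr do rewrite hE.
  by rewrite -mulr_suml x1 mul1r subrr.
elim: n g => [|n IH] g gn greedy gmax e2.
  by apply: flat => //; apply/eqP; rewrite -cards_eq0 -leqn0.
have [L0|[e0 e0L]] := set_0Vmem [set e | g e < g em]%SET; first exact: flat.
pose L := [set e | g e < g em]%SET.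
have memL e : (e \in L) = (g e < g em) by rewrite inE.
have := @arg_maxP _ _ _ e0 (fun e => e \in L) g e0L.
case=> e' e'L e'max.
have e'P e : e \in L -> g e <= g e' by apply: e'max.
have e'm : g e' < g em by rewrite -memL.
pose g' e := Num.min (g e) (g e').
pose D := g em - g e'.
have gE e : g e = g' e + D * (e \notin L)%:R.
  rewrite /g' /D; case: (boolP (e \in L)) => eL.
    by rewrite mulr0 addr0 min_l // e'P.
  have -> : g e = g em by apply/eqP; rewrite eq_le gmax leNgt -memL.
  by rewrite mulr1 min_r ?ltW //; ring.
have g'm : g' em = g e' by rewrite /g' min_r // ltW.
have IHg' : eta * (g' em - g' e2) <=
    average (fun v => g' (ev v)) - \sum_e x e * g' e.
  apply: IH.
  - rewrite -ltnS (leq_trans _ gn) //; apply: proper_card.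
    apply/fintype.properP; split.
      apply/fintype.subsetP => e; rewrite !inE g'm /g' gt_min ltxx orbF => H.
      exact: lt_trans e'm.
    by exists e'; rewrite ?inE // g'm /g' min_r ?lexx // ltxx.
  - by move=> v e ev'; rewrite /g' le_min2 // greedy.
  - by move=> e; rewrite g'm /g' ge_min lexx orbT.
have LP : proper_nonempty L.
  apply/andP; split; first by rewrite proper0; apply/set0Pn; exists e'.
  by rewrite properT; apply/eqP => /setP/(_ em); rewrite !inE ltxx.
pose full := [set v : G | deg L v == deg [set: edge G]%SET v]%SET.
have evL v : (ev v \notin L)%:R = 1 - (v \in full)%:R :> R.
  rewrite /full inE; case: mem_full => [/(_ _ (evP v)) ->|H]; first by rewrite subrr.
  rewrite subr0; case: (boolP (ev v \in L)) => // evL; case: H => e ev'.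
  by rewrite memL (le_lt_trans (greedy v e ev')) // -memL.
have -> : average (fun v => g (ev v)) =
    average (fun v => g' (ev v)) + D * (1 - #|G|%:R^-1 * (dfull L)%:R).
  transitivity (average (fun v => g' (ev v) + D * (1 + - 1 * (v \in full)%:R))).
    by congr (_ * _); apply: eq_bigr => v _; rewrite gE evL mulN1r.
  by rewrite averageD averageZ averageD average_const // averageZ average_card mulN1r.
have -> : \sum_e x e * g e = \sum_e x e * g' e + D * (1 - \sum_(e in L) x e).
  have -> : 1 - \sum_(e in L) x e = \sum_(e | e \notin L) x e.
    by rewrite -x1 [X in X - _](bigID (fun e => e \in L)) /= addrAC subrr add0r.
  rewrite mulr_sumr.
  rewrite [X in _ = _ + X]big_mkcond -big_split; apply: eq_bigr => e _ /=.
  by rewrite gE; case: (e \in L) => /=; ring.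
have D0 : 0 <= D by rewrite /D subr_ge0 ltW.
have := ler_wpM2l D0 (x_slack LP).
have : eta * g' e2 <= eta * g e2.
  by apply: ler_wpM2l; [case/andP: eta_gt0 => /ltW | rewrite /g' ge_min lexx].
rewrite g'm in IHg'; rewrite /D in D0 *.
set A := average _ in IHg' *; set B := \sum_e _ in IHg' *.
set K := \sum_(e in L) _; set d := _ * (dfull L)%:R.
lra.
Qed.

Lemma greedy_drift (g : edge G -> R) (ev : G -> edge G) :
    (forall v, incident (ev v) v) ->
    (forall v e, incident e v -> g e <= g (ev v)) ->
  forall e1 e2, eta * (g e1 - g e2) <= average (fun v => g (ev v)) - \sum_e x e * g e.
Proof.
move=> evP greedy e1 e2.
have := @arg_maxP _ _ _ e1 predT g isT; case=> em _ emax.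
apply: (le_trans _ (greedy_drift_max (leqnn _) evP greedy (em := em) _ e2)); last first.
  by move=> e; apply: emax.
by apply: ler_wpM2l; [case/andP: eta_gt0 => /ltW | rewrite lerD2r; apply: emax].
Qed.

Let m : R := #|edge G|%:R.
(* This choice makes the gain of the drift twice the second-order error: a
   factor [1 - th * eta / m + 2 * th ^+ 2] equals [1 - kappa]. *)
Let th : R := eta / (4 * m).
Let kappa : R := 2 * th ^+ 2.

Let m_gt1 : 2 <= m. Proof. by rewrite ler_nat. Qed.
Let th_gt0 : 0 < th.
Proof. by case/andP: eta_gt0 => h _; rewrite divr_gt0 //; have := m_gt1; lra. Qed.
Let th_le : th <= 2^-1.
Proof.
have := m_gt1; case/andP: eta_gt0 => h0 h1 h.
by rewrite /th ler_pdivrMr; lra.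
Qed.
Let thE : 4 * m * th = eta.
Proof. by rewrite /th; field; rewrite gt_eqF //; have := m_gt1; lra. Qed.

(** The exponential of [th] times the excess of [y] over the point at level [i] of
    the ray through [a] in direction [x], summed over the edges.  Since the
    excesses sum to zero, very negative ones come with large positive ones, and
    controlling the latter suffices. *)
Definition potential (a : config G) (i : nat) (y : config G) : R :=
  \sum_e expR (th * ((y e)%:~R - (a e)%:~R - i%:R * x e)).

(** The greedy rule for the excesses is also greedy for their exponentials [g].
    So [greedy_drift] bounds the first-order term by [- th * eta] times the
    difference of the maximum of [g], at least a share [1 / m] of the potential,
    and some value of [g] at a nonpositive excess, which is at most one. *)
Lemma potential_drift (s : int) (a y : config G) i :
    \sum_e a e = s -> \sum_e y e = s + i.+1%:Z ->
  exists ev : G -> edge G, (forall v, incident (ev v) v) /\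
    average (fun v => potential a i (y - unit_config (ev v))) <=
    (1 - kappa) * potential a i.+1 y + th * eta.
Proof.
move=> aE yE; have [x0 x1] := x_simplex.
pose d e : R := (y e)%:~R - (a e)%:~R - i.+1%:R * x e.
pose g e := expR (th * d e).
have [ev evP] := greedy_choice G_connected G_edges g.
exists ev; split=> [v|]; first by case: (evP v).
have g0 e : 0 < g e by apply: expR_gt0.
have x_le1 e : x e <= 1 by rewrite -x1 (bigD1 e) //= lerDl sumr_ge0.
have step v : potential a i (y - unit_config (ev v)) <=
    (1 + kappa) * \sum_e g e + th * (\sum_e x e * g e) + - th * g (ev v).
  have -> : g (ev v) = \sum_e (e == ev v)%:R * g e.
    rewrite (bigD1 (ev v)) //= eqxx mul1r big1 ?addr0 // => e /negbTE ->.
    by rewrite mul0r.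
  rewrite !mulr_sumr -!big_split; apply: ler_sum => e _ /=.
  have -> : th * (((y - unit_config (ev v)) e)%:~R - (a e)%:~R - i%:R * x e) =
      th * d e + th * (x e - (e == ev v)%:R).
    have -> : ((y - unit_config (ev v)) e)%:~R = (y e)%:~R - (e == ev v)%:R :> R.
      by rewrite !ffunE intrB; case: (e == ev v).
    by rewrite /d -[i.+1%:R]natr1; ring.
  rewrite expRD -/(g e).
  set b : R := (e == ev v)%:R.
  have b01 : 0 <= b <= 1 by rewrite /b; case: (_ == _); rewrite ?lexx ler01.
  have xb : (x e - b) ^+ 2 <= 1.
    have := x0 e; have := x_le1 e; case/andP: b01 => b0 b1 h1 h0.
    rewrite expr2; nra.
  have thx : th * (x e - b) <= 2^-1.
    have := x0 e; have := x_le1 e; case/andP: b01 => b0 b1 h1 h0.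
    apply: (le_trans _ th_le); rewrite -[leRHS]mulr1; apply: ler_wpM2l; last lra.
    exact: ltW.
  have := expR_le_quad thx; set E := expR _ => EP.
  have : E <= 1 + th * (x e - b) + kappa.
    apply: (le_trans EP); rewrite lerD2l /kappa ler_wpM2l // exprMn.
    by rewrite -[leRHS]mulr1; apply: ler_wpM2l => //; apply: sqr_ge0.
  move=> EP'; have := ler_wpM2l (ltW (g0 e)) EP'.
  rewrite /=; lra.
have G0 := vertices_gt0 G_edges.
apply: (le_trans (ler_average step)).
rewrite averageD average_const // averageZ.
have sd : \sum_e d e = 0.
  rewrite sumrB sumrB -mulr_sumr x1 mulr1 -!rmorph_sum /= aE yE -intrB.
  by rewrite addrAC subrr add0r /= subrr.
have [e0 _] := edge_exists G_edges.
have [e2 e2P] : exists e, d e <= 0.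
  apply: contrapT => H.
  have dpos e : 0 < d e by rewrite ltNge; apply/negP => de; apply: H; exists e.
  suff: 0 < \sum_e d e by rewrite sd ltxx.
  rewrite (bigD1 e0) //=; apply: ltr_wpDr => //; apply: sumr_ge0 => e _; exact: ltW.
have [e1 e1P] : exists e1, \sum_e g e <= m * g e1.
  have := @arg_maxP _ _ _ e0 predT g isT; case=> e1 _ e1max.
  exists e1; apply: (@le_trans _ _ (\sum_(e : edge G) g e1)).
    by apply: ler_sum => e _; apply: e1max.
  by rewrite sumr_const -mulr_natl.
have g2 : g e2 <= 1.
  by rewrite /g -expR0 ler_expR; rewrite pmulr_rle0.
have evinc v : incident (ev v) v by case: (evP v).
have greedy v e : incident e v -> g e <= g (ev v) by case: (evP v) => _; apply.
have drift := greedy_drift evinc greedy e1 e2.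
rewrite -[potential a i.+1 y]/(\sum_e g e).
set W := \sum_e g e in e1P *; set X := \sum_e _ in drift *; set A := average _ in drift *.
have h1 := ler_wpM2l (ltW th_gt0) drift.
have eta0 : 0 <= eta by case/andP: eta_gt0 => /ltW.
have the0 : 0 <= th * eta by rewrite mulr_ge0 // ltW.
have h2 : th * eta * g e2 <= th * eta * 1 by apply: ler_wpM2l.
have h3 : 4 * th ^+ 2 * W <= th * eta * g e1.
  have -> : th * eta * g e1 = 4 * th ^+ 2 * (m * g e1) by rewrite -thE; ring.
  by apply: ler_wpM2l => //; rewrite mulr_ge0 // sqr_ge0.
rewrite /kappa; lra.
Qed.

Lemma potential_ge0 a i y : 0 <= potential a i y.
Proof. by apply: sumr_ge0 => e _; apply: expR_ge0. Qed.

(** At level [s] the bound holds because it is not positive unless [y] lies in the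
    ball; the contraction of the potential carries it to all higher levels.  The
    term [2 * m] is the fixed point [th * eta / kappa] of the recursion for the
    mean potential. *)
Lemma steering (s : nat) (a : config G) (r A : R) :
    \sum_e a e = s%:Z -> 0 <= A ->
    (forall y : config G, \sum_e y e = s%:Z ->
       (forall e, (y e)%:~R - (a e)%:~R <= r) -> A <= value s y) ->
  forall i (y : config G), \sum_e y e = (s + i)%:Z ->
    A * (1 - expR (- (th * r)) *
      ((1 - kappa) ^+ i * potential a i y + 2 * m * (1 - (1 - kappa) ^+ i)))
    <= value (s + i) y.
Proof.
move=> aE A0 ball; set q := expR _.
have q0 : 0 < q by apply: expR_gt0.
elim=> [|i IH] y yE.
  rewrite addn0 in yE *; rewrite expr0 mul1r subrr mulr0 addr0.
  have [yr|] := pselect (forall e, (y e)%:~R - (a e)%:~R <= r).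
    apply: (le_trans _ (ball y yE yr)); rewrite -[leRHS]mulr1; apply: ler_wpM2l => //.
    by rewrite gerBl mulr_ge0 ?potential_ge0 // ltW.
  move=> /existsNP [e /negP]; rewrite -ltNge => er.
  apply: (@le_trans _ _ 0); last exact: value_ge0.
  rewrite mulr_ge0_le0 // subr_le0 -(expRxMexpNx_1 (- (th * r))) opprK -/q.
  apply: ler_wpM2l; first exact: ltW.
  rewrite /potential (bigD1 e) //= mul0r subr0.
  apply: (@le_trans _ _ (expR (th * ((y e)%:~R - (a e)%:~R)))).
    by rewrite ler_expR ler_pM2l // ltW.
  by rewrite lerDl sumr_ge0 // => f _; apply: expR_ge0.
have yE' : \sum_e y e = s%:Z + i.+1%:Z by rewrite yE; lia.
have [ev [evP drift]] := potential_drift aE yE'.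
rewrite addnS; apply: (le_trans _ (value_super R (s + i) y evP)).
set c := (1 - kappa) ^+ i in IH *.
have k2 : kappa <= 1.
  rewrite /kappa; have := th_le; have := th_gt0; rewrite expr2 => h1 h2; nra.
have c0 : 0 <= c by rewrite exprn_ge0 // subr_ge0.
have step v : A * (1 - q * (2 * m * (1 - c))) +
    - (A * q * c) * potential a i (y - unit_config (ev v)) <=
    value (s + i) (y - unit_config (ev v)).
  have zE : \sum_e (y - unit_config (ev v)) e = (s + i)%:Z.
    by rewrite sum_sub_unit yE addnS -addn1 PoszD addrK.
  apply: le_trans (IH _ zE).
  by rewrite le_eqVlt; apply/orP; left; apply/eqP; ring.
apply: (le_trans _ (ler_average step)).
rewrite averageD average_const ?vertices_gt0 // averageZ.
set P := average _ in drift *.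
have Aqc : 0 <= A * q * c by rewrite !mulr_ge0 // ltW.
have := ler_wpM2l Aqc drift; rewrite exprS -/c.
set W := potential a i.+1 y.
have -> : th * eta = 2 * m * kappa by rewrite /kappa -thE; ring.
move=> h; lra.
Qed.

(** The radius depends only on [x] and [eps], whereas the ball may lie anywhere:
    its distance to the ray of the sequence only affects how large [n] must be. *)
Lemma steering_sequence (eps : R) : 0 < eps -> exists r : nat,
  forall (s : nat) (a : config G) (A : R), \sum_e a e = s%:Z -> 0 <= A ->
    (forall y : config G, \sum_e y e = s%:Z ->
       (forall e, y e - a e <= r%:Z) -> A <= value s y) ->
  forall (N : nat -> config G) (M : R) (n0 : nat),
    (forall n, (n0 <= n)%N -> \sum_e N n e = n%:Z) ->
    (forall n e, (n0 <= n)%N -> `|(N n e)%:~R - n%:R * x e| <= M) ->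
  exists n1, forall n, (n1 <= n)%N -> A * (1 - eps) <= value n (N n).
Proof.
move=> eps0; pose B := 4 * m / (eps * th).
have m0 : 0 < m by have := m_gt1; lra.
exists (Num.bound B) => s a A aE A0 ball N M n0 NE NM.
have Br : B <= (Num.bound B)%:R.
  by apply/ltW/archi_boundP/ltW/divr_gt0; rewrite mulr_gt0.
set r : nat := Num.bound B in ball Br.
have small : expR (- (th * r%:R)) * (4 * m) <= eps.
  rewrite expRN mulrC ler_pdivrMr ?expR_gt0 //.
  apply: (@le_trans _ _ (eps * (1 + th * r%:R))); last first.
    by rewrite ler_pM2l // expR_ge1Dx.
  rewrite mulrDr mulr1 mulrA; apply: ler_wpDl; first exact: ltW.
  by rewrite [leRHS]mulrC -ler_pdivrMr // mulr_gt0.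
pose W := \sum_e expR (th * (M + `|(a e)%:~R| + s%:R)).
have W0 : 0 <= W by apply: sumr_ge0 => e _; apply: expR_ge0.
have k01 : 0 < kappa <= 1.
  have := th_le; have := th_gt0; rewrite /kappa expr2 => h1 h2.
  by apply/andP; split; nra.
have m20 : 0 < 2 * m by rewrite mulr_gt0.
have [i0 i0P] := geometric_small W0 k01 m20.
exists (maxn n0 (s + i0)) => n; rewrite geq_max => /andP[n0n sin].
have sn : (s <= n)%N by apply: leq_trans sin; apply: leq_addr.
have nE : (s + (n - s) = n)%N by rewrite subnKC.
have ball' (y : config G) : \sum_e y e = s%:Z -> (forall e, (y e)%:~R - (a e)%:~R <= r%:R :> R) ->
    A <= value s y.
  move=> yE yr; apply: ball => // e; have := yr e.
  by rewrite -intrB -[r%:R]/(r%:Z%:~R) ler_int.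
have := steering aE A0 ball' (i := n - s) (y := N n).
rewrite nE => /(_ (NE n n0n)); apply: le_trans; apply: ler_wpM2l => //.
rewrite lerD2l lerN2; apply: le_trans small; apply: ler_wpM2l; first exact: expR_ge0.
have Wle : potential a (n - s) (N n) <= W.
  apply: ler_sum => e _; rewrite ler_expR ler_pM2l //.
  have := NM n e n0n; rewrite ler_norml => /andP[_ h].
  have [x0 x1] := x_simplex.
  have x_le1 : x e <= 1 by rewrite -x1 (bigD1 e) //= lerDl sumr_ge0.
  have h2 : s%:R * x e <= s%:R by rewrite -[leRHS]mulr1; apply: ler_wpM2l.
  have h3 := ler_norm (- (a e)%:~R : R); rewrite normrN in h3.
  rewrite natrB // mulrBl; lra.
have c0 : 0 <= (1 - kappa) ^+ (n - s).
  by rewrite exprn_ge0 // subr_ge0; case/andP: k01.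
have h1 := i0P (n - s)%N; have h2 : (i0 <= n - s)%N by rewrite leq_subRL.
move: {h1 h2}(h1 h2) => h1.
have h3 := ler_wpM2l c0 Wle.
have h4 : 2 * m * (1 - (1 - kappa) ^+ (n - s)) <= 2 * m.
  by rewrite -[leRHS]mulr1; apply: ler_wpM2l; [exact: ltW | rewrite gerBl].
rewrite mulrC in h1; lra.
Qed.

End Steering.

(** * Near the maximal value: catching up with an optimal play *)

Lemma absorb_sub (V : zmodType) (d t g s : V) : d - t + (g + (t + s)) = d + g + s.
Proof. by rewrite [g + _]addrCA !addrA subrK. Qed.

Lemma exchange_move (V : zmodType) (d f g e h : V) :
  d + (f - g) = d + (e - g) + (f - h) - (e - h).
Proof.
rewrite opprB -[RHS]addrA [f - h + _]addrA subrK -[RHS]addrA.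
by congr (_ + _); rewrite [RHS]addrC addrA subrK.
Qed.

Section Liouville.
Variables (R : realType) (G : sgraph).
Hypothesis G_connected : connected_graph G.
Hypothesis G_edges : (2 <= #|edge G|)%N.
Local Notation average := (@average R G).

(** [u j z] stands for the value of the game after [j] rounds in which the edges
    counted by [z] have been removed. *)
Variables (c : R) (u : nat -> config G -> R).
Hypothesis c_ge0 : 0 <= c.
Hypothesis u_ge0 : forall j z, 0 <= u j z.
Hypothesis u_super : forall j z (ev : G -> edge G), (forall v, incident (ev v) v) ->
  average (fun v => u j.+1 (z + unit_config (ev v))) <= u j z.
Hypothesis u_top : forall j z, u j z = c ->
  forall v, exists e : edge G, incident e v /\ u j.+1 (z + unit_config e) = c.
Hypothesis u_start : u 0 0 = c.

(** The player answers by [r0] at the vertex [v0], where he gains more than the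
    bound [b] available at every vertex. *)
Lemma play_step j y (v0 : G) (r0 : edge G) (a b : R) : incident r0 v0 ->
    a <= u j.+1 (y + unit_config r0) -> b <= a ->
    (forall v, exists r : edge G, incident r v /\ b <= u j.+1 (y + unit_config r)) ->
  b + #|G|%:R^-1 * (a - b) <= u j y.
Proof.
move=> r0v0 ar0 ba H; have [r rP] := fin_all_exists H.
pose r' v := if v == v0 then r0 else r v.
have r'P v : incident (r' v) v.
  by rewrite /r'; case: eqP => [->|_] //; case: (rP v).
apply: (le_trans _ (u_super j y r'P)); apply: (@average_one R G v0).
  by rewrite /r' eqxx.
move=> v; rewrite /r'; case: eqP => _; first exact: le_trans ar0.
by case: (rP v).
Qed.

(** A pick that is not accessible cannot occur in the next [L] rounds of any play
    that keeps [u] at its maximal value [c], whatever vertices are drawn. *)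
Fixpoint accessible (L j : nat) (z : config G) (p : G * edge G) : Prop :=
  if L is L'.+1 then
    exists v, exists e : edge G,
      [/\ incident e v, u j.+1 (z + unit_config e) = c &
          (v, e) = p \/ accessible L' j.+1 (z + unit_config e) p]
  else False.

Definition frozen (P : {set G * edge G}) (L j : nat) (z : config G) : Prop :=
  forall p, p \in P -> ~ accessible L j z p.

Lemma accessible_leq L L' j z p : (L <= L')%N ->
  accessible L j z p -> accessible L' j z p.
Proof.
elim: L L' j z => [//|L IH] [//|L'] j z LL' [v [e [ev ze H]]].
exists v, e; split=> //; case: H => [|H]; [by left | right].
exact: (IH L').
Qed.

Lemma frozen_leq P L L' j z : (L <= L')%N -> frozen P L' j z -> frozen P L j z.
Proof. by move=> LL' H p pP /(accessible_leq LL'); apply: H. Qed.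

Lemma frozen_step P L j z v (e : edge G) : incident e v ->
  u j.+1 (z + unit_config e) = c -> frozen P L.+1 j z ->
  frozen P L j.+1 (z + unit_config e).
Proof. by move=> ev ze H p pP pa; apply: (H p pP); exists v, e; split=> //; right. Qed.

Definition persistent (P : {set G * edge G}) : Prop :=
  forall L, exists j z, u j z = c /\ frozen P L j z.

(** For a persistent [P] of maximal size no further pick can be frozen for
    arbitrarily long times, so each pick outside [P] is accessible within a
    bounded time from every point where [P] is frozen. *)
Lemma max_persistent : exists P, persistent P /\
  exists L, forall j z, u j z = c -> frozen P L j z ->
    forall p, p \notin P -> accessible L j z p.
Proof.
have p0 : `[< persistent finset.set0 >].
  by apply/asboolP => L; exists 0%N, 0; split=> // p; rewrite inE.
case: (@arg_maxnP _ finset.set0 (fun P => `[< persistent P >]) (fun P => #|P|) p0).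
move=> P /asboolP Pp Pmax; exists P; split=> //.
have H (p : G * edge G) : exists L, p \notin P -> forall j z, u j z = c ->
    ~ frozen (p |: P)%SET L j z.
  case: (boolP (p \in P)) => pP; first by exists 0%N.
  have : ~ persistent (p |: P)%SET.
    by move/asboolP/Pmax; rewrite /= cardsU1 pP add1n ltnn.
  by move=> /existsNP[L LP]; exists L => _ j z zc zf; apply: LP; exists j, z.
have /fin_all_exists[L LP] := H.
exists (\max_p L p) => j z zc zf p pP; apply: contrapT => pa.
apply: (LP p pP j z zc) => q; rewrite !inE => /orP[/eqP->|qP].
  by move/(accessible_leq (leq_bigmax p)).
by move/(accessible_leq (leq_bigmax p)); apply: zf.
Qed.

Variables (P : {set G * edge G}) (L1 : nat).
Hypothesis P_persistent : persistent P.
Hypothesis P_max : forall j z, u j z = c -> frozen P L1 j z ->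
    forall p, p \notin P -> accessible L1 j z p.

(** A player whose configuration exceeds by [d] that of a maximal play along which
    [P] stays frozen can nearly reach the maximal value. *)
Definition catchable (d : config G) : Prop := forall eps : R, 0 < eps ->
  exists L, forall j z, u j z = c -> frozen P L j z -> c - eps <= u j (z - d).

Lemma catchable0 : catchable 0.
Proof.
by move=> eps eps0; exists 0%N => j z zc _; rewrite subr0 zc gerBl ltW.
Qed.

(** The player copies the maximal play until it picks [e] at [v], and then picks
    [f] instead.  As that pick is always accessible within [L1] rounds, each block
    of [L1] rounds is successful with probability at least [rho = k ^- L1]. *)
Lemma catchable_swap (d : config G) v (e f : edge G) : (v, e) \notin P ->
    incident e v -> incident f v -> catchable d ->
  catchable (d + (unit_config f - unit_config e)).
Proof.
move=> veP ev fv dP eps eps0.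
have k0 : 0 < #|G|%:R^-1 :> R by rewrite invr_gt0 ltr0n vertices_gt0.
have k1 : #|G|%:R^-1 <= 1 :> R.
  by rewrite invf_le1 ?ltr0n ?ler1n vertices_gt0.
pose k : R := #|G|%:R^-1; rewrite -/k in k0 k1.
set d' := d + _.
have [Ls LsP] := dP (eps / 2) (divr_gt0 eps0 (ltr0n _ 2)).
pose X := maxn L1 Ls.
pose rho := k ^+ L1.
have rho01 : 0 < rho <= 1 by rewrite exprn_gt0 // exprn_ile1 // ltW.
pose alpha := c - eps / 2.
pose beta i := alpha - c * (1 - rho) ^+ i.
have beta_le i : beta i <= alpha.
  rewrite gerBl mulr_ge0 // exprn_ge0 // subr_ge0; by case/andP: rho01.
have outer i : forall j z, u j z = c -> frozen P (i * L1 + X) j z -> beta i <= u j (z - d').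
  elim: i => [|i IH] j z zc zf.
    apply: le_trans (u_ge0 _ _); rewrite /beta /alpha expr0; lra.
  (* Within a block: following the [l] draws that lead to the pick [e] at [v]
     ends at [alpha]; any other draw leaves at least [beta i], by copying. *)
  have inner l : forall j z, u j z = c -> frozen P (l + (i * L1 + X)) j z ->
      accessible l j z (v, e) -> beta i + k ^+ l * (alpha - beta i) <= u j (z - d').
    elim: l => [|l IHl] {}j {}z {}zc {}zf //= [v0 [e0 [e0v0 ze0 H]]].
    have copy w : exists r : edge G, incident r w /\ beta i <= u j.+1 (z - d' + unit_config r).
      have [r [rw zr]] := u_top zc w; exists r; split=> //.
      rewrite addrAC; apply: IH => //.
      apply: (@frozen_leq _ _ (l + (i * L1 + X))); first by rewrite leq_addl.
      exact: (frozen_step rw zr).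
    case: H => [[E1 E2]|H].
      apply: (@le_trans _ _ (beta i + k * (alpha - beta i))).
        rewrite lerD2l exprS -mulrA; apply: ler_wpM2l; first exact: ltW.
        rewrite -[leRHS]mul1r; apply: ler_wpM2r; first by rewrite subr_ge0.
        by rewrite exprn_ile1 // ltW.
      apply: (play_step fv _ (beta_le i) copy).
      have -> : z - d' + unit_config f = (z + unit_config e) - d.
        by rewrite /d' opprD opprB !addrA subrK addrAC.
      subst v0 e0; apply: LsP => //.
      apply: (@frozen_leq _ _ (l + (i * L1 + X))); last exact: (frozen_step ev ze0).
      apply: leq_trans (leq_addl _ _); apply: leq_trans (leq_addl _ _).
      exact: leq_maxr.
    rewrite exprS -mulrA.
    have -> : k ^+ l * (alpha - beta i) =
        beta i + k ^+ l * (alpha - beta i) - beta i by ring.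
    apply: (play_step e0v0 _ _ copy).
      rewrite [z - d' + _]addrAC; apply: IHl => //; exact: (frozen_step e0v0 ze0).
    by rewrite lerDl mulr_ge0 ?exprn_ge0 ?subr_ge0 // ltW.
  have zf' : frozen P (L1 + (i * L1 + X)) j z by rewrite addnA -mulSn.
  have acc := P_max zc (frozen_leq (leq_addr _ _) zf') veP.
  apply: le_trans (inner L1 j z zc zf' acc).
  by rewrite /beta exprS -/rho le_eqVlt; apply/orP; left; apply/eqP; ring.
have [i /(_ i (leqnn i)) iP] := geometric_small c_ge0 rho01 (divr_gt0 eps0 (ltr0n _ 2)).
exists (i * L1 + X)%N => j z zc zf; apply: le_trans (outer i j z zc zf).
rewrite /beta /alpha; lra.
Qed.

(** A maximal play must pick some edge when [v] is drawn. *)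
Lemma unfrozen_pick v : exists e : edge G, incident e v /\ (v, e) \notin P.
Proof.
have [j [z [zc zf]]] := P_persistent 1.
have [e [ev ze]] := u_top zc v; exists e; split=> //.
by apply/negP => veP; apply: (zf _ veP); exists v, e; split=> //; left.
Qed.

Variable ev : G -> edge G.
Hypothesis evP : forall v, incident (ev v) v /\ (v, ev v) \notin P.

(** A swap available at a vertex: one more of the edge [p.2], one less of the
    edge that the maximal play keeps picking there. *)
Definition token (p : G * edge G) : config G := unit_config p.2 - unit_config (ev p.1).
Definition is_token (p : G * edge G) : bool := incident p.2 p.1.
Definition all_tokens : config G := \sum_(p | is_token p) token p.

Lemma catchable_token d p : is_token p -> catchable d -> catchable (d + token p).
Proof. by move=> pt; have [? ?] := evP p.1; apply: (@catchable_swap _ p.1). Qed.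

Lemma catchable_sum d (Q : pred (G * edge G)) : (forall p, Q p -> is_token p) ->
  catchable d -> catchable (d + \sum_(p | Q p) token p).
Proof.
move=> Qt; elim/big_rec: _ d => [|p w Qp IH] d dP; first by rewrite addr0.
by rewrite addrA; apply: IH; apply: catchable_token => //; apply: Qt.
Qed.

(** Adding multiples of [all_tokens] moves the centre into the interior of the
    cone spanned by the tokens, where tokens can be subtracted as well. *)
Definition eventually_catchable (d : config G) : Prop :=
  exists N0, forall N, (N0 <= N)%N -> catchable (d + all_tokens *+ N).

Lemma eventually_catchable0 : eventually_catchable 0.
Proof.
exists 0%N => N _; elim: N => [|N IH]; first by rewrite mulr0n addr0; apply: catchable0.
by rewrite mulrSr addrA; apply: catchable_sum.
Qed.

Lemma eventually_catchable_token d p : is_token p ->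
  eventually_catchable d -> eventually_catchable (d + token p).
Proof.
move=> pt [N0 N0P]; exists N0 => N NN; rewrite addrAC.
by apply: catchable_token => //; apply: N0P.
Qed.

Lemma eventually_catchable_untoken d p : is_token p ->
  eventually_catchable d -> eventually_catchable (d - token p).
Proof.
move=> pt [N0 N0P]; exists N0.+1 => -[//|N] NN.
have -> : d - token p + all_tokens *+ N.+1 =
    (d + all_tokens *+ N) + \sum_(q | is_token q && (q != p)) token q.
  have -> : all_tokens *+ N.+1 = all_tokens *+ N +
      (token p + \sum_(q | is_token q && (q != p)) token q).
    by rewrite mulrSr {2}/all_tokens (bigD1 p).
  exact: absorb_sub.
by apply: catchable_sum => [q /andP[]//|]; apply: N0P.
Qed.

(** At a common vertex the difference of two edges is a difference of two tokens;
    other pairs of edges are joined by a chain of such pairs. *)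
Lemma eventually_catchable_move d (f g : edge G) : eventually_catchable d ->
  eventually_catchable (d + (unit_config f - unit_config g)).
Proof.
move: f d; suff H : forall f, (forall d, eventually_catchable d ->
    eventually_catchable (d + (unit_config f - unit_config g))) by [].
move=> f; pose F h := forall d, eventually_catchable d ->
  eventually_catchable (d + (unit_config h - unit_config g)).
apply: (edge_connected G_connected (F := F) _ (e := g)); last first.
  by move=> d; rewrite subrr addr0.
move=> v e {}f ev' fv H d /H dP.
have -> : d + (unit_config f - unit_config g) =
    d + (unit_config e - unit_config g) + token (v, f) - token (v, e).
  exact: (exchange_move _ _ _ _ (unit_config (ev v))).
exact: (eventually_catchable_untoken (p := (v, e)) ev'
  (eventually_catchable_token (p := (v, f)) fv dP)).
Qed.

Lemma eventually_catchable_all (d : config G) : \sum_e d e = 0 -> eventually_catchable d.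
Proof.
move=> d0; have [e0 _] := edge_exists G_edges.
have mul (w : config G) n :
    (forall d, eventually_catchable d -> eventually_catchable (d + w)) ->
    forall d, eventually_catchable d -> eventually_catchable (d + w *+ n).
  move=> H; elim: n => [|n IH] d' d'P; first by rewrite mulr0n addr0.
  by rewrite mulrSr addrA; apply: H; apply: IH.
have mulz f (n : int) d' : eventually_catchable d' ->
    eventually_catchable (d' + (unit_config f - unit_config e0) *~ n).
  case: n => n d'P.
    rewrite -pmulrn; apply: mul => // d'' d''P; exact: eventually_catchable_move.
  rewrite NegzE mulrNz -pmulrn -mulNrn opprB.
  by apply: mul => // d'' d''P; apply: eventually_catchable_move.
have -> : d = 0 + \sum_f (unit_config f - unit_config e0) *~ d f.
  have evalMz (w : config G) (n : int) e : (w *~ n) e = w e *~ n.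
    case: n => n; first by rewrite -!pmulrn ffunMnE.
    by rewrite NegzE !mulrNz -!pmulrn ffunE ffunMnE.
  apply/ffunP => e; rewrite add0r sum_ffunE.
  transitivity (\sum_f ((f == e)%:R * d f - (e == e0)%:R * d f)).
    rewrite sumrB -mulr_sumr d0 mulr0 subr0 (bigD1 e) //= eqxx mul1r big1 ?addr0 //.
    by move=> f /negbTE ->; rewrite mul0r.
  apply: eq_bigr => f _; rewrite evalMz !ffunE -mulrBl [f == e]eq_sym.
  by rewrite mulrzz.
have add_moves s d' : eventually_catchable d' -> eventually_catchable
    (d' + \sum_(f <- s) (unit_config f - unit_config e0) *~ d f).
  elim: s d' => [|f s IH] d' d'P; first by rewrite big_nil addr0.
  by rewrite big_cons addrA; apply: IH; apply: mulz.
exact: (add_moves _ _ eventually_catchable0).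
Qed.

(** The multiple [M] of [all_tokens] is common to the finitely many differences,
    so it only shifts the centre of the ball. *)
Lemma catchable_ball (I : finType) (D : I -> config G) (eps : R) :
    (forall i, \sum_e D i e = 0) -> 0 < eps ->
  exists j z, forall i, c - eps <= u j (z - D i).
Proof.
move=> D0 eps0.
have /fin_all_exists[N NP] := fun i => eventually_catchable_all (D0 i).
pose M := \max_i N i.
have H i : catchable (D i + all_tokens *+ M) by apply: NP; apply: leq_bigmax.
have /fin_all_exists[L LP] := fun i => H i eps eps0.
have [j [z [zc zf]]] := P_persistent (\max_i L i).
exists j, (z - all_tokens *+ M) => i.
have -> : z - all_tokens *+ M - D i = z - (D i + all_tokens *+ M).
  by rewrite opprD addrA addrAC.
by apply: LP => //; apply: frozen_leq zf; apply: leq_bigmax.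
Qed.

End Liouville.

Section LiouvilleMain.
Variables (R : realType) (G : sgraph).
Hypothesis G_connected : connected_graph G.
Hypothesis G_edges : (2 <= #|edge G|)%N.
Local Notation average := (@average R G).

(** A maximum principle: if plays can stay at the level [c] for ever, then [u] is
    nearly at least [c] on some ball of each radius. *)
Lemma near_top_ball (c : R) (u : nat -> config G -> R) :
  0 <= c -> (forall j z, 0 <= u j z) ->
  (forall j z (ev : G -> edge G), (forall v, incident (ev v) v) ->
     average (fun v => u j.+1 (z + unit_config (ev v))) <= u j z) ->
  (forall j z, u j z = c -> forall v, exists e : edge G,
     incident e v /\ u j.+1 (z + unit_config e) = c) ->
  u 0 0 = c ->
  forall (I : finType) (D : I -> config G) (eps : R),
    (forall i, \sum_e D i e = 0) -> 0 < eps ->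
  exists j z, forall i, c - eps <= u j (z - D i).
Proof.
move=> c0 u0 us ut uc.
have [P [Pp [L1 Pm]]] := max_persistent uc.
have /fin_all_exists[ev evP] := unfrozen_pick ut Pp.
move=> I D eps.
exact: (catchable_ball G_connected G_edges c0 u0 us ut Pp Pm evP).
Qed.
End LiouvilleMain.

(** * Limits of the value around near-maximizers *)

Section Limit.
Variables (R : realType) (G : sgraph).
Hypothesis G_connected : connected_graph G.
Hypothesis G_edges : (2 <= #|edge G|)%N.
Local Notation average := (@average R G).
Local Notation value := (@value R G).

Lemma average_le_one (v0 : G) (f : G -> R) a b :
    f v0 <= a -> (forall v, f v <= b) ->
  average f <= b - #|G|%:R^-1 * (b - a).
Proof.
move=> fa fb.
have := @average_one R G v0 (fun v => -1 * f v) (- a) (- b).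
rewrite averageZ !mulN1r lerN2 => /(_ fa) H.
have : forall v, - b <= -1 * f v by move=> v; rewrite mulN1r lerN2.
by move/H; lra.
Qed.

Definition best (n : nat) : R := sup (range (value n)).

Lemma best_has_sup n : has_sup (range (value n)).
Proof.
split; first by exists (value n 0); exists 0.
by exists 1 => _ [z _ <-]; apply: value_le1.
Qed.

Lemma value_le_best n z : value n z <= best n.
Proof. by apply: ub_le_sup; [case: (best_has_sup n) | exists z]. Qed.

Lemma best_decreasing : {homo best : n m / (n <= m)%N >-> m <= n}.
Proof.
apply: homo_leq => [n|m n p mn np|n]; [exact: lexx | exact: le_trans np mn |].
apply: ge_sup; first by case: (best_has_sup n.+1).
move=> _ [z _ <-]; have [ev [_ ->]] := value_opt R G_connected G_edges n z.
rewrite -[leRHS](@average_const R G) ?vertices_gt0 //.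
by apply: ler_average => v; apply: value_le_best.
Qed.

Definition limit_value : R := inf (range best).

Lemma best_cvg : best n @[n --> \oo] --> limit_value.
Proof.
apply: nonincreasing_cvgn; first exact: best_decreasing.
by exists 0 => _ [n _ <-]; apply: le_trans (value_le_best n 0); apply: value_ge0.
Qed.

Lemma limit_value_ge0 : 0 <= limit_value.
Proof.
apply: lb_le_inf; first by exists (best 0); exists 0%N.
by move=> _ [n _ <-]; apply: le_trans (value_le_best n 0); apply: value_ge0.
Qed.

Lemma near_maximizers : exists a : nat -> config G,
  value n (a n) @[n --> \oo] --> limit_value.
Proof.
have H n : exists z, best n - n.+1%:R^-1 < value n z.
  have n0 : 0 < n.+1%:R^-1 :> R by rewrite invr_gt0.
  by have [_ [z _ <-] zP] := sup_adherent n0 (best_has_sup n); exists z.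
have [a aP] := choice H; exists a.
apply: (squeeze_cvgr (f := fun n => best n - n.+1%:R^-1) (h := best)).
- by near=> n; rewrite value_le_best (ltW (aP n)).
- by rewrite -[X in _ --> X]subr0; apply: cvgB; [exact: best_cvg | exact: cvg_harmonic].
- exact: best_cvg.
Unshelve. all: by end_near.
Qed.

(** A cluster point exists by compactness; along an ultrafilter it is a limit. *)
Lemma ultra_cvg (U : set_system nat) (f : nat -> R) : UltraFilter U ->
  (forall n, 0 <= f n <= 1) -> exists l : R, f n @[n --> U] --> l.
Proof.
move=> UU f01; have PU : ProperFilter U by apply: ultra_proper.
have fU : (f @ U) `[0, 1]%classic.
  apply: (@filterS _ U _ setT (f @^-1` `[0, 1]%classic)) filterT => n _.
  by rewrite /= in_itv; apply: f01.
have [l [_ lP]] := @segment_compact R 0 1 (f @ U) _ fU.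
exists l => A Al.
have [//|UA] := in_ultra_setVsetC (f @^-1` A) UU.
have [y [/= fy Ay]] : (~` A) `&` A !=set0 by apply: lP.
by [].
Qed.

(** The ultralimit [u] of the values around near-maximizers satisfies the
    hypotheses of [near_top_ball].  Maximal moves exist because, if all edges at
    [v] lost at least [eta], the value would lose [eta / k] on average, while no
    other vertex can gain. *)
Lemma large_ball_near_limit (I : finType) (D : I -> config G) (eps : R) :
    (forall i, \sum_e D i e = 0) -> 0 < eps ->
  exists s b, forall i, limit_value - eps <= value s (b + D i).
Proof.
move=> D0 eps0; have [a acvg] := near_maximizers.
have [U [UU oU]] := @ultraFilterLemma nat \oo _.
have PU : ProperFilter U by apply: ultra_proper.
have [u uP] : exists u : nat -> config G -> R, forall j z,
    value (n - j) (a n - z) @[n --> U] --> u j z.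
  have H (p : nat * config G) : exists l : R, value (n - p.1) (a n - p.2) @[n --> U] --> l.
    by apply: ultra_cvg => n; rewrite value_ge0 value_le1.
  have [w wP] := choice H; exists (fun j z => w (j, z)) => j z.
  exact: (wP (j, z)).
have Ugt j : \forall n \near U, (j < n)%N by apply: oU; exact: nbhs_infty_gt.
have best_shift j : best (n - j) @[n --> U] --> limit_value.
  apply: cvg_trans (_ : best (n - j) @[n --> \oo] --> limit_value); first exact: cvg_app.
  have := @cvg_centern j _ best (nbhs limit_value).
  by move=> ->; apply: best_cvg.
have uc j z : u j z <= limit_value.
  apply: (ler_cvg_to (uP j z) (best_shift j)).
  by near=> n; apply: value_le_best.
have u0 j z : 0 <= u j z.
  by apply: (cvgr_to_ge (uP j z)); near=> n; apply: value_ge0.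
have subD (n : nat) (z : config G) (e : edge G) :
    a n - (z + unit_config e) = a n - z - unit_config e.
  by rewrite opprD addrA.
have usup j z (ev : G -> edge G) : (forall v, incident (ev v) v) ->
     average (fun v => u j.+1 (z + unit_config (ev v))) <= u j z.
  move=> evP.
  have cv : average (fun v => value (n - j.+1) (a n - (z + unit_config (ev v)))) @[n --> U]
      --> average (fun v => u j.+1 (z + unit_config (ev v))).
    apply: cvgMr; apply: (@cvg_big _ _ +%R); first exact: add_continuous.
    by move=> v _; apply: uP.
  apply: (ler_cvg_to cv (uP j z)); near=> n.
  have jn : (j < n)%N by near: n; apply: Ugt.
  rewrite -(subnSK jn).
  apply: le_trans (value_super R _ (a n - z) evP).
  by apply: ler_average => v; rewrite subD.
have utop j z : u j z = limit_value -> forall v, exists e : edge G,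
    incident e v /\ u j.+1 (z + unit_config e) = limit_value.
  move=> zc v; apply: contrapT => H.
  have Hlt e : incident e v -> 0 < limit_value - u j.+1 (z + unit_config e).
    move=> ev; rewrite subr_gt0 lt_neqAle uc andbT.
    by apply/negP => /eqP E; apply: H; exists e.
  have [eta [/andP[eta0 _] etaP]] := finite_lower_bound Hlt.
  have k0 : 0 < #|G|%:R^-1 :> R by rewrite invr_gt0 ltr0n vertices_gt0.
  have k1 : #|G|%:R^-1 <= 1 :> R.
    by rewrite invf_le1 ?ltr0n ?ler1n vertices_gt0.
  set k : R := #|G|%:R^-1 in k0 k1.
  pose nu := k * eta / 4.
  have nu0 : 0 < nu by rewrite divr_gt0 ?mulr_gt0.
  have [n [jn nval nedge nbest]] : exists n, [/\ (j < n)%N,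
      limit_value - nu <= value (n - j) (a n - z),
      forall e, value (n - j.+1) (a n - (z + unit_config e)) <=
        u j.+1 (z + unit_config e) + nu &
      best (n - j.+1) <= limit_value + nu].
    apply: (@filter_ex _ U _ (fun n => [/\ (j < n)%N,
      limit_value - nu <= value (n - j) (a n - z),
      forall e, value (n - j.+1) (a n - (z + unit_config e)) <=
        u j.+1 (z + unit_config e) + nu &
      best (n - j.+1) <= limit_value + nu])).
    near=> n; split.
    - by near: n; apply: Ugt.
    - near: n; apply: (cvgr_ge _ (uP j z)).
      by rewrite zc gtrBl.
    - near: n; apply: filter_forall => e.
      by apply: (cvgr_le _ (uP j.+1 (z + unit_config e))); rewrite ltrDl.
    - near: n; apply: (cvgr_le _ (best_shift j.+1)); by rewrite ltrDl.
  have [ev [evP E]] := value_opt R G_connected G_edges (n - j.+1) (a n - z).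
  move: nval; rewrite -(subnSK jn) E; apply/negP; rewrite -ltNge.
  apply: (le_lt_trans (average_le_one (v0 := v) (a := limit_value - eta + nu)
    (b := limit_value + nu) _ _)).
  - rewrite -subD; apply: (le_trans (nedge (ev v))); rewrite lerD2r.
    by have := etaP _ (evP v); lra.
  - by move=> w; apply: le_trans nbest; apply: value_le_best.
  - rewrite -/k /nu.
    have -> : limit_value + k * eta / 4 - (limit_value - eta + k * eta / 4) = eta.
      by ring.
    have : 0 < k * eta by rewrite mulr_gt0.
    lra.
have ustart : u 0%N 0 = limit_value.
  apply: (@cvg_unique R^o _ (value n (a n) @[n --> U])) => //.
    suff <- : (fun n => value (n - 0) (a n - 0)) = (fun n => value n (a n)) by exact: uP.
    by apply/funext => n; rewrite subn0 subr0.
  apply: cvg_trans acvg; exact: cvg_app.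
have [j [z zP]] := near_top_ball G_connected G_edges limit_value_ge0 u0 usup utop ustart
  D0 (divr_gt0 eps0 (ltr0n _ 2)).
have [n nP] : exists n, forall i, limit_value - eps <= value (n - j) (a n - (z - D i)).
  apply: (@filter_ex _ U _ (fun n =>
    forall i, limit_value - eps <= value (n - j) (a n - (z - D i)))).
  apply: filter_forall => i; apply: (cvgr_ge _ (uP j (z - D i))).
  by apply: lt_le_trans (zP i); rewrite ltrD2l ltrN2; lra.
exists (n - j)%N, (a n - z) => i.
have -> : a n - z + D i = a n - (z - D i) by rewrite opprB addrA addrAC.
exact: nP.
Unshelve. all: by end_near.
Qed.

End Limit.

(** * Convergence in the winning region *)

Section Winning.
Variables (R : realType) (G : sgraph).
Hypothesis G_connected : connected_graph G.
Hypothesis G_edges : (2 <= #|edge G|)%N.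
Local Notation average := (@average R G).
Local Notation value := (@value R G).

Lemma zero_sum_ge (d : config G) (r : nat) : \sum_e d e = 0 ->
  (forall e, d e <= r%:Z) -> forall e, - (#|edge G| * r)%:Z <= d e.
Proof.
move=> d0 dr e.
have H : \sum_(f | f != e) d f <= (#|edge G| * r)%:Z.
  rewrite PoszM -[#|edge G|%:Z]natz mulr_natl -sumr_const big_mkcond.
  by apply: ler_sum => f _; case: (f != e).
have -> : d e = - \sum_(f | f != e) d f.
  by apply/eqP; rewrite -addr_eq0; move: d0; rewrite (bigD1 e) //= => ->.
by rewrite lerN2.
Qed.

(** An upper bound on the coordinates suffices for finiteness when the sum is
    zero. *)
Lemma finite_ball (r : nat) : exists (I : finType) (D : I -> config G),
  (forall i, \sum_e D i e = 0) /\
  forall d : config G, \sum_e d e = 0 -> (forall e, d e <= r%:Z) -> exists i, D i = d.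
Proof.
pose m := (#|edge G| * r)%N.
pose raw (g : {ffun edge G -> 'I_(m + r).+1}) : config G := [ffun e => (g e)%:Z - m%:Z].
exists {ffun edge G -> 'I_(m + r).+1}.
exists (fun g => if \sum_e raw g e == 0 then raw g else 0); split.
  by move=> g; case: eqP => // _; rewrite big1 // => e _; rewrite ffunE.
move=> d d0 dr; have dm := zero_sum_ge d0 dr.
exists [ffun e => inord (absz (d e + m%:Z))].
have -> : raw [ffun e => inord (absz (d e + m%:Z))] = d.
  apply/ffunP => e; rewrite !ffunE inordK.
    by have := dm e; rewrite -/m; lia.
  by have := dm e; have := dr e; rewrite -/m; lia.
by rewrite d0 eqxx.
Qed.

(** Rounding down all coordinates but one, which absorbs the error. *)
Lemma rounding (x : edge G -> R) : exists (N : nat -> config G) (M : R),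
  (forall n, \sum_e N n e = n%:Z) /\
  (simplex x -> forall n e, `|(N n e)%:~R - n%:R * x e| <= M).
Proof.
have [e0 _] := edge_exists G_edges.
pose fl n e : int := Num.floor (n%:R * x e).
pose N n : config G := [ffun e => if e == e0 then n%:Z - \sum_(f | f != e0) fl n f else fl n e].
exists N, (\sum_(e : edge G) 1 + 1); split=> [n|[x0 x1] n e].
  rewrite (bigD1 e0) //= ffunE eqxx.
  have -> : \sum_(f | f != e0) N n f = \sum_(f | f != e0) fl n f.
    by apply: eq_bigr => f /negbTE fe0; rewrite ffunE fe0.
  exact: subrK.
have M0 : 0 <= \sum_(e : edge G) 1 :> R by apply: sumr_ge0.
have flP f : 0 <= n%:R * x f - (fl n f)%:~R <= 1.
  have := floor_le (n%:R * x f); have := lt_succ_floor (n%:R * x f).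
  by rewrite -/(fl n f) intrD; lra.
rewrite ffunE; case: eqP => [->|_]; last first.
  by have := flP e; rewrite ler_norml; lra.
have E : (n%:Z - \sum_(f | f != e0) fl n f)%:~R - n%:R * x e0 =
    \sum_(f | f != e0) (n%:R * x f - (fl n f)%:~R) :> R.
  rewrite intrB sumrB -mulr_sumr rmorph_sum /=.
  have : \sum_(f | f != e0) x f = 1 - x e0.
    by rewrite -x1 [in RHS](bigD1 e0) //= addrAC subrr add0r.
  move=> ->; rewrite mulrBr mulr1; ring.
rewrite E ger0_norm; last by apply: sumr_ge0 => f _; case/andP: (flP f).
apply: (@le_trans _ _ (\sum_(f : edge G) 1)); last by rewrite lerDl.
rewrite big_mkcond; apply: ler_sum => f _; case: (f != e0) => //.
by case/andP: (flP f).
Qed.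

(** The ball around the constant configuration [h] consists of nonnegative
    configurations, as coordinates of sum zero bounded above by [r] are at least
    [- h]. *)
Lemma limit_value_gt0 : 0 < limit_value R G.
Proof.
have Wc := center_win R G_connected G_edges.
have [eta [eta01 slack]] := win_region_slack Wc.
have Sc := center_simplex R G_connected G_edges.
have half : 0 < 2^-1 :> R by rewrite invr_gt0.
have [r rP] := steering_sequence G_connected G_edges Sc eta01 slack half.
pose h := (#|edge G| * r)%N; pose s := (#|edge G| * h)%N.
pose a : config G := [ffun=> h%:Z].
have aE : \sum_e a e = s%:Z.
  under eq_bigr do rewrite ffunE.
  by rewrite sumr_const -mulr_natl natz -PoszM.
have k0 : 0 < #|G|%:R^-1 :> R by rewrite invr_gt0 ltr0n vertices_gt0.
have ball (y : config G) : \sum_e y e = s%:Z -> (forall e, y e - a e <= r%:Z) ->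
    #|G|%:R^-1 ^+ s <= value s y.
  move=> yE yr; apply: value_gt0 => // e.
  have d0 : \sum_e (y - a) e = 0.
    have -> : \sum_e (y - a) e = \sum_e y e - \sum_e a e.
      by rewrite -sumrB; apply: eq_bigr => f _; rewrite !ffunE.
    by rewrite yE aE subrr.
  have dr f : (y - a) f <= r%:Z by have := yr f; rewrite !ffunE.
  by have := zero_sum_ge d0 dr e; rewrite !ffunE lerBrDr addNr.
have [N [M [NE NM]]] := rounding (@center R G).
have [n1 n1P] := rP s a _ aE (exprn_ge0 s (ltW k0)) ball N M 0%N
  (fun n _ => NE n) (fun n e _ => NM Sc n e).
apply: (@lt_le_trans _ _ (#|G|%:R^-1 ^+ s * (1 - 2^-1))).
  by rewrite mulr_gt0 ?exprn_gt0 //; lra.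
apply: (cvgr_to_ge (@best_cvg R G G_connected G_edges)).
exists n1 => // n n1n /=.
exact: le_trans (n1P n n1n) (value_le_best R G_connected G_edges n (N n)).
Qed.

Lemma opt_prob_cvg (x : edge G -> R) (N : nat -> config G) :
  win_region x -> config_seq x N ->
  opt_prob R (N n) @[n --> \oo] --> limit_value R G.
Proof.
move=> Wx HN; have [eta [eta01 slack]] := win_region_slack Wx.
have [Sx _] := Wx; have c0 := limit_value_gt0.
have [M [n0 [_ NM]]] := config_seq_bounded HN.
have [_ NE _] := HN.
apply/cvgrPdist_le => eps eps0.
pose eps1 := Num.min (eps / 2) (limit_value R G / 2).
have eps10 : 0 < eps1 by rewrite lt_min !divr_gt0.
have eps1a : eps1 <= eps / 2 by rewrite ge_min lexx.
have eps1b : eps1 <= limit_value R G / 2 by rewrite ge_min lexx orbT.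
have c1 : limit_value R G <= 1.
  apply: (cvgr_to_le (@best_cvg R G G_connected G_edges)); near=> n.
  by apply: ge_sup => [|_ [z _ <-]]; [exists (value n 0); exists 0 | apply: value_le1].
have [r rP] := steering_sequence G_connected G_edges Sx eta01 slack (divr_gt0 eps0 (ltr0n _ 2)).
have [I [D [D0 Dall]]] := finite_ball r.
have [s [a aP]] := large_ball_near_limit G_connected G_edges D0 eps10.
have aE : \sum_e a e = s%:Z.
  apply: (@value_sum R G G_connected G_edges); rewrite gt_eqF //.
  have [i iE] : exists i, D i = 0.
    by apply: Dall => [|e]; [rewrite big1 // => e _|]; rewrite ffunE.
  have := aP i; rewrite iE addr0; apply: lt_le_trans; lra.
have ball (y : config G) : \sum_e y e = s%:Z -> (forall e, y e - a e <= r%:Z) ->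
    limit_value R G - eps1 <= value s y.
  move=> yE yr; have [i iE] : exists i, D i = y - a.
    apply: Dall => [|e]; last by have := yr e; rewrite !ffunE.
    have -> : \sum_e (y - a) e = \sum_e y e - \sum_e a e.
      by rewrite -sumrB; apply: eq_bigr => f _; rewrite !ffunE.
    by rewrite yE aE subrr.
  have -> : y = a + D i by rewrite iE addrC subrK.
  exact: aP.
have A0 : 0 <= limit_value R G - eps1 by lra.
have [n1 n1P] := rP s a _ aE A0 ball N M n0.+1
  (fun n n0n => NE n (leq_trans (ltn0Sn _) n0n))
  (fun n e n0n => NM n e (ltnW n0n)).
near=> n.
have npos : (0 < n)%N by near: n; exact: nbhs_infty_gt.
have n1n : (n1 <= n)%N by near: n; exact: nbhs_infty_ge.
rewrite (config_seq_value G_connected G_edges HN npos).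
have low := n1P n n1n.
have up : value n (N n) <= limit_value R G + eps.
  apply: le_trans (value_le_best R G_connected G_edges n (N n)) _.
  near: n; apply: (cvgr_le _ (@best_cvg R G G_connected G_edges)); by rewrite ltrDl.
rewrite ler_norml; apply/andP; split; first lra.
have : (limit_value R G - eps1) * (eps / 2) <= 1 * (eps / 2).
  by apply: ler_wpM2r; lra.
lra.
Unshelve. all: by end_near.
Qed.

End Winning.

Unset Implicit Arguments.
Set Strict Implicit.

Theorem theorem1 (R : realType) (G : sgraph)
    (G_connected : connected_graph G) (G_edges : (2 <= #|edge G|)%N) :
  (exists lambda : (edge G -> R) -> R,
    (forall x : edge G -> R, lose_region x ->
       0 < lambda x /\
       forall N : nat -> config G, config_seq x N ->
         (log_rate R N <= (- lambda x)%:E)%E) /\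
    (forall S : set (edge G -> R), S `<=` @lose_region R G ->
       positive_distance S (@win_region R G) ->
       (0 < ereal_inf [set (lambda x)%:E | x in S])%E)) /\
  (exists c : R, 0 < c /\
    forall (x : edge G -> R) (N : nat -> config G),
      win_region x -> config_seq x N ->
      opt_prob R (N n) @[n --> \oo] --> c).
Proof.
split.
  exists (fun x => deficit x ^+ 2 / 8); split.
    move=> x Lx; have d0 := deficit_gt0 Lx; split; first by rewrite divr_gt0 ?exprn_gt0.
    by move=> N HN; apply: log_rate_le => //; case: Lx.
  move=> S SL Sd.
  have [eps [eps0 epsP]] := positive_distance_deficit G_connected G_edges SL Sd.
  apply: (@lt_le_trans _ _ (eps ^+ 2 / 8)%:E); first by rewrite lte_fin divr_gt0 ?exprn_gt0.
  apply/ereal_infP => _ [x Sx <-]; rewrite lee_fin ler_pM2r //.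
  have epsx := epsP x Sx.
  by apply: lerXn2r => //; rewrite nnegrE ltW // (lt_le_trans eps0).
exists (limit_value R G); split; first exact: limit_value_gt0.
by move=> x N; apply: opt_prob_cvg.
Qed.
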